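(* Let $X$ be an infinite dimensional Banach space which has Property $(\mathcal P_C)$ for some $C>1$. Then, for any infinite dimensional Banach space $Y$ and any real sequence $(\alpha_k)_{k\in\mathbb N}$ with $\alpha_1\geq\alpha_2\geq\ldots\geq0$ and $\lim_k\alpha_k=0$, there exists $T\in B(X,Y)$ such that $$\frac{1}{20C^2}\,\alpha_{18m}\leq c_m^{(\Pi_{tr})}(T)\leq a_m^{(\Pi_{tr})}(T)\leq 4\,\alpha_{\lceil4m/5\rceil}$$ for every $m\in\mathbb N$, and for any $t$ and $r$ satisfying $1\leq r\leq\min\{2,t\}$ and $1/r-1/t<1/2$.
   Context: $B(X,Y)$ is the space of bounded linear operators from $X$ to $Y$. A Banach space $X$ has Property $(\mathcal P_C)$ ($C\geq1$) if for any $n\in\mathbb N$ and any closed finite codimensional subspace $X'\subset X$ there exists an $n$-dimensional subspace $E\subset X'$ such that $d(E,\ell_2^n)\leq C$ and $E$ is $C$-complemented in $X$ (i.e. it is the range of a projection on $X$ of norm at most $C$). Here $d$ is the Banach-Mazur distance, $d(E,F)=\inf\|u\|\,\|u^{-1}\|$ over invertible $u:E\to F$. An operator $T\in B(X,Y)$ is $(t,r)$-summing ($1\leq r\leq t\leq\infty$) if there is a constant $C'$ such that for all $x_1,\dots,x_n\in X$, $$\Big(\sum_{i=1}^n\|Tx_i\|^t\Big)^{1/t}\leq C'\Big(\sup_{x^*\in X^*,\,\|x^*\|\leq1}\sum_{i=1}^n|\langle x^*,x_i\rangle|^r\Big)^{1/r}.$$ The infimum of all such $C'>0$ is $\pi_{t,r}(T)$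 (with value $\infty$ if $T$ is not $(t,r)$-summing), and $\Pi_{tr}$ is the corresponding ideal. For $T\in B(X,Y)$ and $n\geq1$, $$a_n^{(\Pi_{tr})}(T)=\inf_{u\in B(X,Y),\ \mathrm{rank}\,u<n}\pi_{t,r}(T-u),\qquad c_n^{(\Pi_{tr})}(T)=\inf_{E\subset X\text{ closed subspace},\ \mathrm{codim}\,E<n}\pi_{t,r}(T|_E).$$
   Formalization: The operator T is chosen after t and r and may depend on them; a single T for all t and r at once is impossible in general (e.g. X=Y=ℓ₂ and α_k=1/log(k+1)). *)

(* Defs.v *)
From HB Require Import structures.
From mathcomp Require Import all_boot all_order all_algebra.
From mathcomp Require Import all_classical all_reals all_analysis.
From mathcomp Require Import complex.

Set Implicit Arguments.
Unset Strict Implicit.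
Unset Printing Implicit Defensive.

Import Order.TTheory GRing.Theory Num.Theory.
Import numFieldNormedType.Exports.

Local Open Scope classical_set_scope.
Local Open Scope ring_scope.

(* Banach spaces are taken over the reals or over the complex numbers. *)
Variant scalar_kind := RealScalars | ComplexScalars.

Definition scalar_field (R : realType) (s : scalar_kind) : numFieldType :=
  if s is RealScalars then R : numFieldType else R[i] : numFieldType.

Definition scalar_re (R : realType) (s : scalar_kind) : scalar_field R s -> R :=
  match s return scalar_field R s -> R with
  | RealScalars => fun x => x
  | ComplexScalars => fun z => complex.Re z
  end.

Section linear_algebra.
Variable K : numFieldType.
Implicit Types V W : lmodType K.

Definition lincomb V n (e : 'I_n -> V) (a : 'rV[K]_n) : V :=
  \sum_i a 0 i *: e i.

Definition subspace V (E : set V) : Prop :=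
  E 0 /\ forall (a : K) x y, E x -> E y -> E (a *: x + y).

(* For a subspace E. *)
Definition has_dim V (E : set V) (n : nat) : Prop :=
  exists e : 'I_n -> V, (forall i, E (e i)) /\
    forall x, E x -> exists! a : 'rV[K]_n, x = lincomb e a.

(* For a subspace E: the classes of the e i form a basis of V / E. *)
Definition has_codim V (E : set V) (n : nat) : Prop :=
  exists e : 'I_n -> V, forall x, exists! a : 'rV[K]_n, E (x - lincomb e a).

Definition infinite_dim V : Prop := forall n, ~ has_dim [set: V] n.

Definition rank_lt V W (u : V -> W) (n : nat) : Prop :=
  exists2 k, (k < n)%N & has_dim (range u) k.

(* An operator defined on a subspace E is represented by a function on the
   whole space, of which only the values on E matter. *)
Definition linear_on V W (E : set V) (f : V -> W) : Prop :=
  forall (a : K) x y, E x -> E y -> f (a *: x + y) = a *: f x + f y.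

End linear_algebra.

Section operators.
Variables (R : realType) (s : scalar_kind).
Local Notation K := (scalar_field R s).

(* Norms in a normedModType K are K-valued; this is the same norm in R. *)
Definition rnorm (V : normedZmodType K) (x : V) : R := scalar_re `|x|.

Definition l2norm n (a : 'rV[K]_n) : R :=
  Num.sqrt (\sum_i rnorm (a 0 i) ^+ 2).

Definition bounded_op (V W : normedModType K) (u : V -> W) : Prop :=
  bounded_near u (nbhs (0 : V)).

(* Norm of f as an operator from (E, NV) to (W, NW). *)
Definition opnorm (V W : lmodType K) (NV : V -> R) (NW : W -> R)
    (E : set V) (f : V -> W) : \bar R :=
  ereal_sup [set (NW (f x))%:E | x in [set x | E x /\ NV x <= 1]].

(* Banach-Mazur distance between (E, NV) and (F, NW); v is the inverse of u. *)
Definition bm_dist (V W : lmodType K) (NV : V -> R) (NW : W -> R)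
    (E : set V) (F : set W) : \bar R :=
  ereal_inf [set d | exists (u : V -> W) (v : W -> V),
    [/\ linear_on E u, linear_on F v,
        (forall x, E x -> F (u x) /\ v (u x) = x),
        (forall y, F y -> E (v y) /\ u (v y) = y) &
        d = (opnorm NV NW E u * opnorm NW NV F v)%E]].

Definition complemented (X : normedModType K) (C : R) (E : set X) : Prop :=
  exists P : {linear X -> X},
    [/\ bounded_op P, (forall x, P (P x) = P x), range P = E &
        (opnorm (@rnorm X) (@rnorm X) setT P <= C%:E)%E].

Definition property_P (X : normedModType K) (C : R) : Prop :=
  forall (n : nat) (X' : set X), (0 < n)%N ->
    subspace X' -> closed X' -> (exists k, has_codim X' k) ->
    exists E : set X,
      [/\ subspace E, has_dim E n, E `<=` X',
          (bm_dist (@rnorm X) (@l2norm n) E setT <= C%:E)%E &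
          complemented C E].

Definition lnorm (t : \bar R) n (a : 'I_n -> R) : R :=
  match t with
  | p%:E => (\sum_i `|a i| `^ p) `^ p^-1
  | +oo%E => \big[Num.max/0]_i `|a i|
  | -oo%E => 0
  end.

Definition dual_ball (X : normedModType K) (E : set X) : set (X -> K^o) :=
  [set f | linear_on E f /\ (opnorm (@rnorm X) (@rnorm K^o) E f <= 1)%E].

Definition weak_norm (X : normedModType K) (E : set X) (r : R) n
    (x : 'I_n -> X) : \bar R :=
  poweR (ereal_sup [set (\sum_i rnorm (f (x i)) `^ r)%:E | f in dual_ball E])
        r^-1.

(* The (t,r)-summing norm of the restriction of T to the subspace E. *)
Definition summing_norm (X Y : normedModType K) (t : \bar R) (r : R)
    (E : set X) (T : X -> Y) : \bar R :=
  ereal_inf [set c%:E | c in [set c : R | 0 < c /\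
    forall n (x : 'I_n -> X), (forall i, E (x i)) ->
      ((lnorm t (fun i => rnorm (T (x i))))%:E <= c%:E * weak_norm E r x)%E]].

Definition approx_num (X Y : normedModType K) (t : \bar R) (r : R)
    (T : X -> Y) (m : nat) : \bar R :=
  ereal_inf [set summing_norm t r setT (T \- u) | u in
    [set u : X -> Y | [/\ linear u, bounded_op u & rank_lt u m]]].

Definition gelfand_num (X Y : normedModType K) (t : \bar R) (r : R)
    (T : X -> Y) (m : nat) : \bar R :=
  ereal_inf [set summing_norm t r E T | E in
    [set E : set X | [/\ subspace E, closed E &
                         exists2 k, (k < m)%N & has_codim E k]]].

End operators.

(* Main.v *)
Require Import Defs.
From HB Require Import structures.
From mathcomp Require Import all_boot all_order all_algebra fingroup perm.
From mathcomp Require Import all_classical all_reals all_analysis.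
From mathcomp Require Import complex lra ring zify.
Import Order.TTheory GRing.Theory Num.Theory.
Import numFieldNormedType.Exports.
Local Open Scope classical_set_scope.
Local Open Scope ring_scope.

(* T is a sum of blocks B_i : X -> Y, the i-th of rank 5^(i+1), with weights
   w_i = 2 (a_i - a_(i+1)) / C, where a lies between alpha(5^(i+1)) and twice
   that and at least halves whenever it decreases.  The weights telescope,
   which bounds the approximation numbers; below any i some j >= i has
   w_j >= alpha(5^(i+1)) / C, so the lower bound reduces to one block.

   A block factors through a C-complemented, C-Hilbertian subspace E of X of
   dimension n, on which all previous blocks vanish.  No Euclidean section of
   Y is needed: among the operators S from E to Y of (t,r)-summing norm at
   most 1, choose one which nearly maximises the determinant of S with respect
   to fixed functionals on Y.  If S were small on a subspace of E of dimension
   at least n/2, then S (1 + 3 Q), with Q the orthogonal projection onto this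
   subspace, would have a determinant at least 2^n times larger and a norm at
   most 8/5, against maximality.

   On E the later blocks of T do not cancel the current one, because they take
   their values in a finite codimensional subspace Z of Y with
   |y| <= 2 |y + z| for y in the range of the current block and z in Z
   (Mazur's argument). *)

(** The blocks depend on the given exponents t and r: each is optimised for its own (t,r)-summing
    norm, and no value of that norm has to be computed.

    Earlier and later blocks are treated differently because of the order of construction: E can be
    chosen inside the kernels of the blocks already built, whereas the later ones do not exist yet
    and can only be restricted in their range.

    The sequence alpha(5^(i+1)) may decrease so slowly that all its differences are small compared
    with its values; passing to a concentrates the decrease in large steps.

    The first i blocks have total rank (5^(i+1) - 5)/4, which gives 4m/5 in the upper bound. In the
    lower bound a block of dimension at least 2m is needed, and the least such power of 5 is either
    5 or below 10m, hence at most 18m. The constant 1/(20 C^2) is the product of 1/5 (determinant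
    argument), 1/(2C) (distortion of E), 1/C (weight) and 1/2 (Mazur's argument). *)

Set Implicit Arguments.
Unset Strict Implicit.
Unset Printing Implicit Defensive.

(* MathComp-Analysis has another constant named subspace (a topology). *)
Local Notation subspace := Defs.subspace.

(** * The scalar field *)

Section scalars.
Variables (R : realType) (s : scalar_kind).
Local Notation K := (scalar_field R s).

(** Through this embedding, inequalities between K-valued norms become inequalities in R ([normE],
    [semb_le]), so that only a few lemmas distinguish the two kinds of scalars. *)
Definition semb : {rmorphism R -> K} :=
  match s return {rmorphism R -> scalar_field R s} with
  | RealScalars => idfun
  | ComplexScalars => real_complex R
  end.

Definition sconj : {rmorphism K -> K} :=
  match s return {rmorphism scalar_field R s -> scalar_field R s} with
  | RealScalars => idfun
  | ComplexScalars => @conjc R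
  end.

Lemma scalar_re_sembM a (x : K) : scalar_re (semb a * x) = a * scalar_re x.
Proof. by rewrite /semb; case: s x => // -[c d] /=; rewrite mul0r subr0. Qed.

Lemma sembK a : scalar_re (semb a) = a.
Proof. by rewrite /semb; case: s. Qed.

Lemma semb_le a b : (semb a <= semb b) = (a <= b).
Proof. by rewrite /semb; case: s => //=; rewrite lecR. Qed.

Lemma semb_lt a b : (semb a < semb b) = (a < b).
Proof. by rewrite /semb; case: s => //=; rewrite ltcR. Qed.

Lemma scalar_re_ge0 (x : K) : 0 <= x -> semb (scalar_re x) = x.
Proof.
rewrite /semb; case: s x => /= [//|[a b]].
by rewrite lecE /= => /andP[/eqP -> _].
Qed.

Lemma norm_semb a : `|semb a| = semb `|a|.
Proof. by rewrite /semb; case: s => //=; rewrite normc_def /= expr0n /= addr0 sqrtr_sqr. Qed.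

Lemma sconjK (x : K) : sconj (sconj x) = x.
Proof. by rewrite /sconj; case: s x => //= -[a b] /=; rewrite opprK. Qed.

Lemma sconj_semb a : sconj (semb a) = semb a.
Proof. by rewrite /sconj /semb; case: s => //=; rewrite oppr0. Qed.

Lemma normE (V : normedZmodType K) (x : V) : `|x| = semb (rnorm x).
Proof. by rewrite scalar_re_ge0. Qed.

Lemma rnorm_ge0 (V : normedZmodType K) (x : V) : 0 <= rnorm x.
Proof. by rewrite -semb_le -normE rmorph0. Qed.

Lemma rnormD (V : normedZmodType K) (x y : V) : rnorm (x + y) <= rnorm x + rnorm y.
Proof. by rewrite -semb_le rmorphD -!normE ler_normD. Qed.

Lemma rnorm0 (V : normedZmodType K) : rnorm (0 : V) = 0.
Proof. by rewrite /rnorm normr0 -(rmorph0 semb) sembK. Qed.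

Lemma rnorm0_eq0 (V : normedZmodType K) (x : V) : rnorm x = 0 -> x = 0.
Proof. by move=> x0; apply/normr0_eq0; rewrite normE x0 rmorph0. Qed.

Lemma rnorm_gt0 (V : normedZmodType K) (x : V) : (0 < rnorm x) = (x != 0).
Proof.
rewrite lt0r rnorm_ge0 andbT; congr (~~ _); apply/eqP/eqP => [/rnorm0_eq0//|->].
exact: rnorm0.
Qed.

Lemma rnormN (V : normedZmodType K) (x : V) : rnorm (- x) = rnorm x.
Proof. by rewrite /rnorm normrN. Qed.

Lemma rnormB (V : normedZmodType K) (x y : V) : rnorm (x - y) <= rnorm x + rnorm y.
Proof. by rewrite (le_trans (rnormD _ _)) ?rnormN. Qed.

Lemma rnormZ (V : normedModType K) (a : K) (x : V) : rnorm (a *: x) = rnorm a * rnorm x.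
Proof. by rewrite /rnorm normrZ [`|a|]normE scalar_re_sembM sembK. Qed.

Lemma rnormM (a b : K) : rnorm (a * b) = rnorm a * rnorm b.
Proof. by rewrite /rnorm normrM [`|a|]normE scalar_re_sembM sembK. Qed.

Lemma rnorm1 : rnorm (1 : K) = 1.
Proof. by rewrite /rnorm normr1 -(rmorph1 semb) sembK. Qed.

Lemma rnorm_semb a : rnorm (semb a) = `|a|.
Proof. by rewrite /rnorm norm_semb sembK. Qed.

Lemma rnormX (a : K) n : rnorm (a ^+ n) = rnorm a ^+ n.
Proof. by elim: n => [|n IH]; rewrite ?expr0 ?rnorm1// !exprS rnormM IH. Qed.

Lemma rnorm_sum (V : normedZmodType K) I (r : seq I) (P : pred I) (F : I -> V) :
  rnorm (\sum_(i <- r | P i) F i) <= \sum_(i <- r | P i) rnorm (F i).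
Proof.
elim/big_ind2 : _ => // [|x a y b xa yb]; first by rewrite rnorm0.
by rewrite (le_trans (rnormD _ _)) ?lerD.
Qed.

Lemma mul_sconj (x : K) : x * sconj x = semb (rnorm x ^+ 2).
Proof.
rewrite /sconj /semb /rnorm; case: s x => [x|z] /=.
  by rewrite real_normK ?num_real // expr2.
rewrite -[LHS]/(z * conjc z) -[RHS]/((complex.Re `|z| ^+ 2)%:C)%C normc_def /=.
case: z => a b; rewrite sqr_sqrtr ?addr_ge0 ?sqr_ge0//; simpc.
by apply/eqP; rewrite eq_complex /=; apply/andP; split; apply/eqP; ring.
Qed.

Lemma rnorm_sconj (x : K) : rnorm (sconj x) = rnorm x.
Proof.
have : rnorm (sconj x) ^+ 2 = rnorm x ^+ 2.
  by apply: (can_inj sembK); rewrite -!mul_sconj sconjK mulrC.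
by move=> /eqP; rewrite eqrXn2 ?rnorm_ge0// => /eqP.
Qed.

End scalars.

(** * Dimension and codimension *)

Section linear_algebra.
Variable K : numFieldType.
Implicit Types V W : lmodType K.

Lemma linearP_exists V W (f : V -> W) : linear f -> exists g : {linear V -> W}, g =1 f.
Proof.
move=> lf.
pose m := GRing.isLinear.Build K V W *:%R f lf.
by exists (HB.pack_for {linear V -> W} f m).
Qed.

Lemma lincomb_is_linear V n (e : 'I_n -> V) : linear (lincomb e).
Proof.
move=> c a b; rewrite /lincomb scaler_sumr -big_split /=; apply: eq_bigr => i _.
by rewrite !mxE scalerDl scalerA.
Qed.

HB.instance Definition _ V n (e : 'I_n -> V) :=
  GRing.isLinear.Build K 'rV[K]_n V *:%R (lincomb e) (lincomb_is_linear e).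

Lemma lincomb_mulmx V m n (y : 'I_n -> V) (B : 'M[K]_(m, n)) (a : 'rV[K]_m) :
  lincomb y (a *m B) = lincomb (fun j => lincomb y (row j B)) a.
Proof.
rewrite /lincomb; under [RHS]eq_bigr do rewrite scaler_sumr.
rewrite exchange_big; apply: eq_bigr => i _ /=.
by rewrite mxE scaler_suml; apply: eq_bigr => j _; rewrite mxE scalerA.
Qed.

Lemma lincomb_linear V W (f : {linear V -> W}) n (e : 'I_n -> V) a :
  f (lincomb e a) = lincomb (f \o e) a.
Proof. by rewrite /lincomb linear_sum; apply: eq_bigr => i _; rewrite linearZ. Qed.

Lemma left_kernel_exists N n (B : 'M[K]_(N, n)) : (n < N)%N ->
  exists2 a : 'rV[K]_N, a != 0 & a *m B = 0.
Proof.
move=> nN; have : kermx B != 0.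
  by rewrite -mxrank_eq0 mxrank_ker subn_eq0 -ltnNge (leq_ltn_trans (rank_leq_col _)).
case/rowV0Pn => a aB a0; exists a => //.
exact/sub_kermxP.
Qed.

Section subspaces.
Variable V : lmodType K.
Implicit Types E G : set V.

Lemma subspaceB E x y : subspace E -> E x -> E y -> E (x - y).
Proof. by move=> [E0 Ec] Ex Ey; rewrite addrC -scaleN1r; exact: Ec. Qed.

Lemma subspaceD E x y : subspace E -> E x -> E y -> E (x + y).
Proof. by move=> [E0 Ec] Ex Ey; rewrite -[x]scale1r; exact: Ec. Qed.

Lemma subspaceZ E a x : subspace E -> E x -> E (a *: x).
Proof. by move=> [E0 Ec] Ex; rewrite -[_ *: _]addr0; exact: Ec. Qed.

Lemma subspace_sum E I (r : seq I) (P : pred I) (F : I -> V) : subspace E ->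
  (forall i, P i -> E (F i)) -> E (\sum_(i <- r | P i) F i).
Proof.
move=> sE FE; elim/big_ind : _ => //; first by case: sE.
by move=> x y; exact: subspaceD.
Qed.

Lemma subspace_lincomb E n (e : 'I_n -> V) a : subspace E ->
  (forall i, E (e i)) -> E (lincomb e a).
Proof. by move=> sE eE; apply: subspace_sum => // i _; apply: subspaceZ. Qed.

Definition indep_mod E n (e : 'I_n -> V) := forall a, E (lincomb e a) -> a = 0.

(** Take a longest family in G that is independent modulo E. Adjoining any x of G makes it
    dependent, necessarily with a nonzero coefficient at x, and the relation is solved for x. *)
Lemma relative_basis E G N : subspace E -> subspace G ->
  (forall e : 'I_N.+1 -> V, (forall i, G (e i)) -> ~ indep_mod E e) ->
  exists k, (k <= N)%N /\ exists e : 'I_k -> V, (forall i, G (e i)) /\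
    forall x, G x -> exists! a : 'rV[K]_k, E (x - lincomb e a).
Proof.
move=> sE sG hN.
pose P k := exists e : 'I_k -> V, (forall i, G (e i)) /\ indep_mod E e.
have P0 : P 0%N by exists (fun=> 0); split=> [[]//|a _]; rewrite [a]thinmx0.
have [k [kN [e [eG eE]] Pk1]] : exists k, [/\ (k <= N)%N, P k & ~ P k.+1].
  have : ~ P N.+1 by move=> [e [eG]]; exact: hN.
  elim: N {hN} => [|N IH] PN; first by exists 0%N.
  have [PN1|/IH[k [kN Pk Pk1]]] := pselect (P N.+1); first by exists N.+1.
  by exists k; rewrite leqW.
exists k; split=> //; exists e; split=> // x Gx.
pose e' (i : 'I_k.+1) := if unlift ord0 i is Some j then e j else x.
have e'E a : lincomb e' a = a 0 ord0 *: x + lincomb e (\row_j a 0 (lift ord0 j)).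
  rewrite /lincomb big_ord_recl /e' unlift_none; congr (_ + _).
  by apply: eq_bigr => i _; rewrite liftK mxE.
have : ~ indep_mod E e'.
  move=> h; apply: Pk1; exists e'; split=> // i; rewrite /e'.
  by case: unliftP => [j _|_]; [exact: eG|].
move=> /existsNP[a /not_implyP[Ea a0]]; rewrite e'E in Ea.
set b := \row_j _ in Ea.
have c0 : a 0 ord0 != 0.
  apply/eqP => c0; apply: a0; rewrite c0 scale0r add0r in Ea.
  have /eE b0 := Ea; apply/rowP => i; rewrite mxE.
  case: (unliftP ord0 i) => [j ->|->//]; have /rowP/(_ j) := b0.
  by rewrite !mxE.
exists (- (a 0 ord0)^-1 *: b); split.
  rewrite linearZ /= scaleNr opprK -[x](scalerK c0) -scalerDr.
  exact: subspaceZ.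
move=> b' Eb'; apply/eqP; rewrite -subr_eq0; apply/eqP/eE.
have := subspaceZ (a 0 ord0)^-1 sE Ea; rewrite scalerDr scalerK // => Eb.
have := subspaceB sE Eb' Eb; rewrite opprD addrACA subrr add0r => h.
rewrite linearB linearZ /= scaleNr.
by rewrite addrC.
Qed.

End subspaces.

Lemma subspace_ker V W (u : {linear V -> W}) : subspace [set x | u x = 0].
Proof.
split=> [|a x y /= ux uy]; first exact: linear0.
by rewrite linearP ux uy scaler0 addr0.
Qed.

Lemma subspace_range V W (f : {linear V -> W}) : subspace (range f).
Proof.
split; first by exists 0 => //; exact: linear0.
by move=> c _ _ [x _ <-] [z _ <-]; exists (c *: x + z) => //; rewrite linearP.
Qed.

Lemma finite_rank_has_dim V W (u : {linear V -> W}) n (y : 'I_n -> W) :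
  (forall x, exists a, u x = lincomb y a) ->
  exists2 k, (k <= n)%N & has_dim (range u) k.
Proof.
move=> uy.
have s0 : subspace [set (0 : W)].
  by split=> // a x z /= -> ->; rewrite scaler0 addr0.
have sr := subspace_range u.
have [e eG ind|k [kn [e [eG ee]]]] := @relative_basis _ _ _ n s0 sr.
  have /choice[b eb] : forall j, exists a, e j = lincomb y a.
    by move=> j; have [x _ <-] := eG j; exact: uy.
  have [a a0 ab] := left_kernel_exists (\matrix_j b j) (ltnSn n).
  move/eqP: a0; apply; apply: ind => /=.
  suff -> : lincomb e a = lincomb y (a *m \matrix_j b j) by rewrite ab linear0.
  rewrite lincomb_mulmx; congr lincomb; apply/funext => j.
  by rewrite rowK eb.
exists k => //; exists e; split=> // x /ee[a [xa au]]; exists a; split.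
  by apply/eqP; rewrite -subr_eq0; apply/eqP.
by move=> b xb; apply: au; rewrite /= xb subrr.
Qed.

Lemma has_codim_ker V W (u : {linear V -> W}) k :
  has_dim (range u) k -> has_codim [set x | u x = 0] k.
Proof.
move=> [f [fr fu]].
have /choice[e ef] : forall i, exists x, u x = f i.
  by move=> i; have [x _ <-] := fr i; exists x.
exists e => x; have [|a [ua au]] := fu (u x); first by exists x.
have ue b : u (lincomb e b) = lincomb f b.
  by rewrite lincomb_linear; congr lincomb; apply/funext => i; exact: ef.
exists a; split=> [|b] /=; first by rewrite linearB /= ue ua subrr.
by rewrite linearB /= ue => /subr0_eq /au.
Qed.

(** These are the coordinates in V / G; their uniqueness makes them linear. They turn a subspace of
    codimension k into a matrix with k columns in the determinant argument. *)
Lemma has_codim_coords V (G : set V) k : subspace G -> has_codim G k ->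
  exists phi : {linear V -> 'rV[K]_k}, forall x, phi x = 0 -> G x.
Proof.
move=> sG [e eG].
have /choice[f fe] : forall x, exists a, G (x - lincomb e a).
  by move=> x; have [a []] := eG x; exists a.
have fu x a : G (x - lincomb e a) -> f x = a.
  by have [b [_ bu]] := eG x; move=> /bu <-; rewrite (bu _ (fe x)).
have [|phi phiE] := @linearP_exists V 'rV[K]_k f.
  move=> c x y; apply: fu; rewrite linearP opprD addrACA -scalerBr.
  by case: sG => _; apply.
exists phi => x; rewrite phiE => fx; have := fe x.
by rewrite fx linear0 subr0.
Qed.

Lemma infinite_dim_ker V N (phi : {linear V -> 'rV[K]_N}) : infinite_dim V ->
  exists2 x, x != 0 & phi x = 0.
Proof.
move=> hV.
have s0 : subspace [set (0 : V)].
  by split=> // a x z /= -> ->; rewrite scaler0 addr0.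
have sT : subspace [set: V] by [].
have [e ei] : exists e : 'I_N.+1 -> V, indep_mod [set 0] e.
  apply: contrapT => he.
  have [e _ ei|k [_ [e [_ ee]]]] := @relative_basis _ _ _ N s0 sT.
    by apply: he; exists e.
  apply: (hV k); exists e; split=> // x /ee[a [xa au]]; exists a; split.
    by apply/eqP; rewrite -subr_eq0; apply/eqP.
  by move=> b xb; apply: au; rewrite /= xb subrr.
have [a a0 aB] := left_kernel_exists (\matrix_j phi (e j)) (ltnSn N).
exists (lincomb e a); first by apply/eqP => /ei /eqP; exact/negP.
rewrite lincomb_linear -aB.
apply/rowP => i; rewrite /lincomb summxE mxE; apply: eq_bigr => j _.
by rewrite !mxE.
Qed.

End linear_algebra.

(** * Finite l_p norms *)

Section lnorm.
Variable R : realType.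
Implicit Types p q r : R.

Lemma sumr_powR_ge0 p n (a : 'I_n -> R) : 0 <= \sum_i `|a i| `^ p.
Proof. by apply: sumr_ge0 => i _; exact: powR_ge0. Qed.

Lemma lnorm_ge0 p n (a : 'I_n -> R) : 0 <= lnorm p%:E a.
Proof. exact: powR_ge0. Qed.

Lemma lnorm_powR p n (a : 'I_n -> R) : 1 <= p ->
  (lnorm p%:E a) `^ p = \sum_i `|a i| `^ p.
Proof.
move=> p1; rewrite /lnorm -powRrM mulVf ?powRr1 ?sumr_powR_ge0//.
by rewrite gt_eqF// (lt_le_trans _ p1).
Qed.

Lemma lnorm_le1 p n (a : 'I_n -> R) c : 1 <= p -> 0 <= c ->
  \sum_i `|a i| `^ p <= c `^ p -> lnorm p%:E a <= c.
Proof.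
move=> p1 c0 h; rewrite /lnorm.
have p0 : 0 < p by rewrite (lt_le_trans _ p1).
rewrite -[leRHS](powRr1 c0) -(mulfV (lt0r_neq0 p0)) powRrM.
by rewrite ge0_ler_powR ?invr_ge0 ?(ltW p0)// nnegrE ?sumr_powR_ge0 ?powR_ge0.
Qed.

Lemma ler_lnorm p n (a b : 'I_n -> R) : 1 <= p ->
  (forall i, `|a i| <= `|b i|) -> lnorm p%:E a <= lnorm p%:E b.
Proof.
move=> p1 ab; apply: lnorm_le1 => //; first exact: lnorm_ge0.
rewrite lnorm_powR//; apply: ler_sum => i _.
by rewrite ge0_ler_powR// ?nnegrE// (le_trans _ p1).
Qed.

Lemma lnormZ p n (a : 'I_n -> R) c : 1 <= p ->
  lnorm p%:E (fun i => c * a i) = `|c| * lnorm p%:E a.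
Proof.
move=> p1; rewrite /lnorm; under eq_bigr do rewrite normrM powRM//.
rewrite -mulr_sumr powRM ?sumr_powR_ge0 ?powR_ge0// -powRrM mulfV ?powRr1//.
by rewrite gt_eqF// (lt_le_trans _ p1).
Qed.

Lemma lnorm_eq0 p n (a : 'I_n -> R) : 1 <= p -> lnorm p%:E a = 0 -> forall i, a i = 0.
Proof.
move=> p1 a0; have := lnorm_powR a p1; rewrite a0 powR0; last first.
  by rewrite gt_eqF// (lt_le_trans _ p1).
move=> /esym/eqP; rewrite psumr_eq0; last by move=> i _; exact: powR_ge0.
move=> /allP h i; have := h i (mem_index_enum _).
by rewrite powR_eq0 normr_eq0 => /andP[/eqP].
Qed.

Lemma powR_convex p (l x y : R) : 1 <= p -> 0 <= l <= 1 -> 0 <= x -> 0 <= y ->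
  (l * x + (1 - l) * y) `^ p <= l * x `^ p + (1 - l) * y `^ p.
Proof.
move=> p1 /andP[l0 l1] x0 y0.
have := @convex_powR R p p1 (Itv01 l0 l1) x y.
by rewrite !inE /= !in_itv /= !andbT !convRE /=; apply.
Qed.

(** Minkowski's inequality. With A and B the norms of a and b, (a + b)/(A + B) is the convex
    combination of a/A and b/B with weights A/(A + B) and B/(A + B); convexity of the p-th power is
    applied to each coordinate and summed. *)
Lemma lnormD p n (a b : 'I_n -> R) : 1 <= p ->
  lnorm p%:E (fun i => a i + b i) <= lnorm p%:E a + lnorm p%:E b.
Proof.
move=> p1.
have [A0|A0] := eqVneq (lnorm p%:E a) 0.
  rewrite A0 add0r; apply: ler_lnorm => // i.
  by rewrite (lnorm_eq0 p1 A0) add0r.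
have [B0|B0] := eqVneq (lnorm p%:E b) 0.
  rewrite B0 addr0; apply: ler_lnorm => // i.
  by rewrite (lnorm_eq0 p1 B0) addr0.
have {}A0 : 0 < lnorm p%:E a by rewrite lt0r A0 lnorm_ge0.
have {}B0 : 0 < lnorm p%:E b by rewrite lt0r B0 lnorm_ge0.
move AE : (lnorm p%:E a) A0 => A A0; move BE : (lnorm p%:E b) B0 => B B0.
have AB0 : 0 < A + B by rewrite addr_gt0.
apply: lnorm_le1 => //; first exact: ltW.
have h i : `|a i + b i| `^ p <= (A + B) `^ p *
    (A / (A + B) * (`|a i| `^ p / A `^ p) + (1 - A / (A + B)) * (`|b i| `^ p / B `^ p)).
  have Ep (c : R) x : 0 < c -> `|x| `^ p / c `^ p = (`|x| / c) `^ p.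
    move=> c0; rewrite powRM ?invr_ge0 ?(ltW c0)//; congr (_ * _).
    by rewrite -(powR_inv1 (ltW c0)) powRAC powR_inv1 ?powR_ge0.
  rewrite !Ep//; set l := A / (A + B).
  have l01 : 0 <= l <= 1.
    by rewrite /l divr_ge0 ?(ltW A0) ?(ltW AB0)//= ler_pdivrMr// mul1r lerDl ltW.
  have := @powR_convex p l (`|a i| / A) (`|b i| / B) p1 l01.
  move=> /(_ (divr_ge0 (normr_ge0 _) (ltW A0)) (divr_ge0 (normr_ge0 _) (ltW B0))).
  move=> /(ler_wpM2l (powR_ge0 (A + B) p)); apply: le_trans.
  case/andP: l01 => l0 l1.
  rewrite -powRM ?(ltW AB0)//; last first.
    by rewrite addr_ge0// mulr_ge0// ?subr_ge0// divr_ge0// ltW.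
  have -> : (A + B) * (l * (`|a i| / A) + (1 - l) * (`|b i| / B)) = `|a i| + `|b i|.
    by rewrite /l; field; rewrite !gt_eqF.
  by rewrite ge0_ler_powR ?nnegrE ?addr_ge0 ?ler_normD ?(le_trans _ p1).
apply: (le_trans (ler_sum _ (fun i _ => h i))).
rewrite -mulr_sumr big_split /= -!mulr_sumr -!mulr_suml -!lnorm_powR// AE BE.
rewrite !divff ?gt_eqF ?powR_gt0// !mulr1.
by rewrite [A / _ + _]addrC subrK mulr1.
Qed.

(** Every coordinate is at most the r-norm A, so |a_i|^p is at most A^(p-r) |a_i|^r. *)
Lemma lnorm_antimono p r n (a : 'I_n -> R) : 1 <= r -> r <= p ->
  lnorm p%:E a <= lnorm r%:E a.
Proof.
move=> r1 rp; have p1 := le_trans r1 rp.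
have r0 : 0 < r by rewrite (lt_le_trans _ r1).
have [A0|A0] := eqVneq (lnorm r%:E a) 0.
  apply: lnorm_le1 => //; first exact: lnorm_ge0.
  rewrite A0 powR0 ?gt_eqF ?(lt_le_trans _ p1)// big1// => i _.
  by rewrite (lnorm_eq0 r1 A0) normr0 powR0// gt_eqF ?(lt_le_trans _ p1).
have {}A0 : 0 < lnorm r%:E a by rewrite lt0r A0 lnorm_ge0.
have ar := lnorm_powR a r1.
move AE : (lnorm r%:E a) A0 ar => A A0 ar.
apply: lnorm_le1 => //; first exact: ltW.
have -> : A `^ p = A `^ (p - r) * \sum_i `|a i| `^ r.
  by rewrite -ar -powRD ?subrK// lt0r_neq0// implybT.
rewrite mulr_sumr; apply: ler_sum => i _.
have aA : `|a i| <= A.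
  rewrite -(@ler_pXn2r _ 1)// ?nnegrE ?(ltW A0)//.
  rewrite !expr1 -[leLHS]powRr1// -[leRHS]powRr1 ?(ltW A0)// -(mulfV (lt0r_neq0 r0)).
  rewrite !powRrM ge0_ler_powR ?invr_ge0 ?(ltW r0) ?nnegrE ?powR_ge0// ar.
  rewrite (bigD1 i)//= lerDl; apply: sumr_ge0 => j _; exact: powR_ge0.
have [->|a0] := eqVneq (a i) 0.
  by rewrite normr0 !powR0 ?mulr0// gt_eqF// (lt_le_trans _ p1).
rewrite -{1}(subrK r p) (@powRD _ `|a i|); last by rewrite normr_eq0 a0 implybT.
by rewrite ler_wpM2r ?powR_ge0// ge0_ler_powR ?nnegrE ?subr_ge0// ltW.
Qed.

Lemma lnorm_le_const p n (a : 'I_n -> R) e : 1 <= p -> (forall i, `|a i| <= e) ->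
  lnorm p%:E a <= n%:R * e.
Proof.
move=> p1 ae; apply: (le_trans (lnorm_antimono _ _ p1)) => //.
rewrite /lnorm invr1 powRr1 ?sumr_powR_ge0//.
under eq_bigr do rewrite powRr1//.
apply: (le_trans (ler_sum _ (fun i _ => ae i))).
by rewrite sumr_const card_ord mulr_natl.
Qed.

Lemma lnorm_ord1 p (a : 'I_1 -> R) : 1 <= p -> lnorm p%:E a = `|a ord0|.
Proof.
move=> p1; rewrite /lnorm big_ord1 -powRrM mulfV ?powRr1//.
by rewrite gt_eqF// (lt_le_trans _ p1).
Qed.

End lnorm.

(** * Summing operators *)

Section opnorm.
Variables (R : realType) (s : scalar_kind).
Local Notation K := (scalar_field R s).

Lemma opnorm_leP (V W : lmodType K) (NV : V -> R) (NW : W -> R) (E : set V)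
    (f : V -> W) (M : R) :
  (forall a x, NV (semb R s a *: x) = `|a| * NV x) ->
  (forall a y, NW (semb R s a *: y) = `|a| * NW y) ->
  (forall x, 0 <= NV x) -> 0 <= M -> subspace E -> linear_on E f ->
  (opnorm NV NW E f <= M%:E)%E <-> (forall x, E x -> NW (f x) <= M * NV x).
Proof.
move=> hV hW NV0 M0 sE lf; split=> [h x Ex|h]; last first.
  apply: ge_ereal_sup => _ [x [Ex x1] <-]; rewrite lee_fin.
  by rewrite (le_trans (h _ Ex))// ler_piMr.
have fZ a : f (semb R s a *: x) = semb R s a *: f x.
  case: sE => E0 _; have f0 : f 0 = 0.
    have := lf 1 0 0 E0 E0; rewrite !scale1r addr0 => /eqP.
    by rewrite -subr_eq0 opprD addrA subrr sub0r oppr_eq0 => /eqP.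
  by have := lf (semb R s a) x 0 Ex E0; rewrite f0 !addr0.
(* Scaling by NV x + e instead of NV x covers the case NV x = 0. *)
have key e : 0 < e -> NW (f x) <= M * (NV x + e).
  move=> e0; have xe : 0 < NV x + e by rewrite ltr_wpDl.
  pose a := (NV x + e)^-1.
  have a0 : 0 < a by rewrite invr_gt0.
  have : ((NW (f (semb R s a *: x)))%:E <= M%:E)%E.
    apply: le_trans h; apply: ereal_sup_ubound; exists (semb R s a *: x) => //.
    split; first exact: subspaceZ.
    by rewrite hV gtr0_norm// mulrC ler_pdivrMr// mul1r lerDl ltW.
  by rewrite lee_fin fZ hW gtr0_norm// mulrC ler_pdivrMr.
apply/ler_addgt0Pr => e e0.
have M1 : 0 < M + 1 by rewrite ltr_wpDl.
apply: (le_trans (key (e / (M + 1)) (divr_gt0 e0 M1))).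
rewrite mulrDr lerD2l mulrA ler_pdivrMr// mulrC ler_wpM2l ?(ltW e0)//.
by rewrite lerDl.
Qed.

Lemma rnormZ_semb (V : normedModType K) a (x : V) :
  rnorm (semb R s a *: x) = `|a| * rnorm x.
Proof. by rewrite rnormZ rnorm_semb. Qed.

Lemma dual_ballP (X : normedModType K) (E : set X) f : subspace E ->
  dual_ball E f <-> linear_on E f /\ forall x, E x -> rnorm (f x) <= rnorm x.
Proof.
move=> sE; have hX := @rnormZ_semb X.
have hK (a : R) (y : K^o) : rnorm (semb R s a *: y) = `|a| * rnorm y.
  exact: (@rnormZ_semb K^o).
split=> -[lf].
  move/(opnorm_leP hX hK (@rnorm_ge0 _ _ X) ler01 sE lf) => h; split=> // x Ex.
  by rewrite -[leRHS]mul1r h.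
move=> h; split=> //.
apply/(opnorm_leP hX hK (@rnorm_ge0 _ _ X) ler01 sE lf) => x Ex.
by rewrite mul1r h.
Qed.

End opnorm.

Section summing.
Variables (R : realType) (s : scalar_kind) (p r : R).
Local Notation K := (scalar_field R s).
Hypotheses (r1 : 1 <= r) (rp : r <= p).

Let p1 : 1 <= p := le_trans r1 rp.
Let r0 : 0 < r := lt_le_trans ltr01 r1.

(** A real-valued substitute for [summing_norm], with c = 0 allowed, so that sums, multiples and
    restrictions are estimated in R; [summing_norm_le] and [summing_norm_ge] translate back. *)
Definition summing_bound (X Y : normedModType K) (E : set X) (T : X -> Y) (c : R) :=
  0 <= c /\ forall n (x : 'I_n -> X), (forall i, E (x i)) ->
    ((lnorm p%:E (fun i => rnorm (T (x i))))%:E <= c%:E * weak_norm E r x)%E.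

Section weak.
Variable X : normedModType K.
Implicit Types E G : set X.

Lemma lnorm_weak E n (x : 'I_n -> X) f : dual_ball E f ->
  ((lnorm r%:E (fun i => rnorm (f (x i))))%:E <= weak_norm E r x)%E.
Proof.
move=> fE; rewrite /weak_norm /lnorm -poweR_EFin.
under eq_bigr do rewrite ger0_norm ?rnorm_ge0//.
have h : ((\sum_i rnorm (f (x i)) `^ r)%:E <=
    ereal_sup [set (\sum_i rnorm (f (x i)) `^ r)%:E | f in dual_ball E])%E.
  by apply: ereal_sup_ubound; exists f.
have s0 : (0 <= (\sum_i rnorm (f (x i)) `^ r)%:E)%E.
  by rewrite lee_fin sumr_ge0// => i _; exact: powR_ge0.
apply: gt0_ler_poweR; rewrite ?invr_ge0 ?(ltW r0)// in_itv/= ?leey ?andbT//.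
exact: le_trans h.
Qed.

Lemma weak_norm_le E n (x : 'I_n -> X) c : 0 <= c ->
  (forall f, dual_ball E f -> lnorm r%:E (fun i => rnorm (f (x i))) <= c) ->
  (weak_norm E r x <= c%:E)%E.
Proof.
move=> c0 h; rewrite /weak_norm.
have -> : c%:E = poweR (c `^ r)%:E r^-1.
  by rewrite poweR_EFin -powRrM mulfV ?gt_eqF// powRr1.
have hs : (ereal_sup [set (\sum_i rnorm (f (x i)) `^ r)%:E | f in dual_ball E] <= (c `^ r)%:E)%E.
  apply: ge_ereal_sup => _ [f fE <-]; rewrite lee_fin.
  have -> : \sum_i rnorm (f (x i)) `^ r = lnorm r%:E (fun i => rnorm (f (x i))) `^ r.
    by rewrite lnorm_powR//; apply: eq_bigr => i _; rewrite ger0_norm ?rnorm_ge0.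
  by rewrite ge0_ler_powR ?(ltW r0) ?nnegrE ?lnorm_ge0 ?h.
have [f0|f0] := pselect (exists f, dual_ball E f).
  case: f0 => f fE; apply: gt0_ler_poweR; rewrite ?invr_ge0 ?(ltW r0)// in_itv/= ?leey ?andbT//.
    apply: le_trans (ereal_sup_ubound _); last by exists f.
    by rewrite lee_fin sumr_ge0// => i _; exact: powR_ge0.
  by rewrite lee_fin powR_ge0.
(* An empty dual ball would give the supremum -oo, whose power is 0 by convention. *)
rewrite (_ : [set _ | _ in _] = set0) ?ereal_sup0.
  by rewrite /poweR invr_eq0 gt_eqF// lee_fin powR_ge0.
by apply/seteqP; split=> // z [f fE _]; apply: f0; exists f.
Qed.

Lemma weak_norm_ge0 E n (x : 'I_n -> X) : (0 <= weak_norm E r x)%E.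
Proof. exact: poweR_ge0. Qed.

Lemma weak_norm_fin E n (x : 'I_n -> X) : subspace E -> (forall i, E (x i)) ->
  exists2 w, 0 <= w & weak_norm E r x = w%:E.
Proof.
move=> sE xE; have : (weak_norm E r x <= (lnorm r%:E (fun i => rnorm (x i)))%:E)%E.
  apply: weak_norm_le => [|f /(dual_ballP _ sE)[_ fE]]; first exact: lnorm_ge0.
  by apply: ler_lnorm => // i; rewrite !ger0_norm ?rnorm_ge0 ?fE.
have := weak_norm_ge0 E x.
by move: (weak_norm E r x) => [w|//|//] w0 _; exists w.
Qed.

End weak.

(** For f in the dual ball of E, the functional q^-1 f o Q lies in the dual ball of G. *)
Lemma weak_norm_comp (X Z : normedModType K) (G : set Z) (E : set X) (Q : Z -> X) q n (x : 'I_n -> Z) :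
  subspace E -> subspace G -> linear_on G Q ->
  (forall z, G z -> E (Q z)) -> 0 < q -> (forall z, G z -> rnorm (Q z) <= q * rnorm z) ->
  (forall i, G (x i)) ->
  (weak_norm E r (Q \o x) <= q%:E * weak_norm G r x)%E.
Proof.
move=> sE sG lQ QE q0 Qq xG.
have [w w0 wE] := weak_norm_fin sG xG; rewrite wE -EFinM.
apply: weak_norm_le => [|f fE]; first by rewrite mulr_ge0// ltW.
have /(dual_ballP _ sE)[lf fn] := fE.
pose g z := (semb R s q^-1 : K) * f (Q z).
have gb : dual_ball G (g : Z -> K^o).
  apply/dual_ballP => //; split=> [a x1 y1 Gx Gy|z Gz].
    rewrite /g lQ// lf; [|exact: QE..].
    by rewrite mulrDr; congr (_ + _); rewrite -[a *: _]/(a * _) -[in RHS]/(a * _) mulrCA.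
  rewrite /g -[rnorm _]/(rnorm ((semb R s q^-1 : K) *: (f (Q z) : K^o))).
  rewrite rnormZ_semb ger0_norm ?invr_ge0 ?(ltW q0)// mulrC ler_pdivrMr//.
  by rewrite (le_trans (fn _ (QE _ Gz)))// mulrC Qq.
have := lnorm_weak x gb; rewrite wE lee_fin => h.
have -> : (fun i => rnorm (f ((Q \o x) i))) = (fun i => q * rnorm (g (x i))).
  apply/funext => i; rewrite /g /= rnormM rnorm_semb ger0_norm ?invr_ge0 ?(ltW q0)//.
  by rewrite mulrA mulfV ?mul1r ?gt_eqF.
by rewrite lnormZ// ger0_norm ?(ltW q0)// ler_wpM2l// ltW.
Qed.

Lemma weak_norm_sub (X : normedModType K) (E G : set X) n (x : 'I_n -> X) : subspace E -> subspace G ->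
  G `<=` E -> (forall i, G (x i)) -> (weak_norm E r x <= weak_norm G r x)%E.
Proof.
move=> sE sG GE xG; rewrite -[leRHS]mul1e.
by apply: (@weak_norm_comp X X G E id 1) => // z _; rewrite mul1r.
Qed.

Lemma weak_norm1 (X : normedModType K) (E : set X) x : subspace E -> E x ->
  (weak_norm E r (fun _ : 'I_1 => x) <= (rnorm x)%:E)%E.
Proof.
move=> sE Ex; apply: weak_norm_le => [|f /(dual_ballP _ sE)[_ fE]]; first exact: rnorm_ge0.
by rewrite lnorm_ord1// ger0_norm ?rnorm_ge0// fE.
Qed.

Section bounds.
Variables X Y : normedModType K.
Implicit Types (E G : set X) (T S : X -> Y).

Lemma summing_boundP E T c : subspace E -> 0 <= c ->
  (forall n (x : 'I_n -> X) w, (forall i, E (x i)) -> 0 <= w -> weak_norm E r x = w%:E ->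
    lnorm p%:E (fun i => rnorm (T (x i))) <= c * w) -> summing_bound E T c.
Proof.
move=> sE c0 h; split=> [|n x xE]; first exact: c0.
have [w w0 wE] := weak_norm_fin sE xE.
by rewrite wE -EFinM lee_fin; apply: h.
Qed.

Lemma summing_boundE E T c n (x : 'I_n -> X) w : summing_bound E T c ->
  (forall i, E (x i)) -> weak_norm E r x = w%:E ->
  lnorm p%:E (fun i => rnorm (T (x i))) <= c * w.
Proof. by move=> [c0 h] xE wE; have := h n x xE; rewrite wE -EFinM lee_fin. Qed.

Lemma eq_summing_bound E T S c : (forall x, E x -> T x = S x) ->
  summing_bound E T c -> summing_bound E S c.
Proof.
move=> TS [c0 h]; split=> [|n x xE]; first exact: c0.
have -> : (fun i => rnorm (S (x i))) = (fun i => rnorm (T (x i))).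
  by apply/funext => i; rewrite TS.
exact: h.
Qed.

Lemma summing_bound_le E T c d : c <= d -> summing_bound E T c -> summing_bound E T d.
Proof.
move=> cd [c0 h]; split=> [|n x xE]; first exact: le_trans cd.
by rewrite (le_trans (h _ _ xE))// lee_wpmul2r ?lee_fin ?weak_norm_ge0.
Qed.

Lemma summing_bound_norm E T c x : subspace E -> summing_bound E T c -> E x ->
  rnorm (T x) <= c * rnorm x.
Proof.
move=> sE [c0 h] Ex; have := h 1%N (fun=> x) (fun=> Ex).
rewrite lnorm_ord1// ger0_norm ?rnorm_ge0// => /le_trans h1.
rewrite -lee_fin EFinM; apply: h1.
by rewrite lee_wpmul2l ?lee_fin ?weak_norm1.
Qed.

Lemma summing_boundD E T S c d : subspace E ->
  summing_bound E T c -> summing_bound E S d ->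
  summing_bound E (fun x => T x + S x) (c + d).
Proof.
move=> sE Tc Sd; apply: summing_boundP => // [|n x w xE w0 wE].
  by case: Tc Sd => c0 _ [d0 _]; exact: addr_ge0.
apply: (@le_trans _ _ (lnorm p%:E (fun i => rnorm (T (x i)) + rnorm (S (x i))))).
  apply: ler_lnorm => // i; rewrite !ger0_norm ?addr_ge0 ?rnorm_ge0//.
  exact: rnormD.
apply: (le_trans (lnormD _ _ p1)); rewrite mulrDl lerD//.
  exact: summing_boundE Tc _ _.
exact: summing_boundE Sd _ _.
Qed.

Lemma summing_boundZ E T c (a : K) : subspace E -> summing_bound E T c ->
  summing_bound E (fun x => a *: T x) (rnorm a * c).
Proof.
move=> sE Tc; apply: summing_boundP => // [|n x w xE w0 wE].
  by case: Tc => c0 _; rewrite mulr_ge0 ?rnorm_ge0.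
have -> : (fun i => rnorm (a *: T (x i))) = (fun i => rnorm a * rnorm (T (x i))).
  by apply/funext => i; rewrite rnormZ.
rewrite lnormZ// ger0_norm ?rnorm_ge0// -mulrA ler_wpM2l ?rnorm_ge0//.
exact: summing_boundE Tc _ _.
Qed.

Lemma summing_bound0 E : subspace E -> summing_bound E (fun _ => 0 : Y) 0.
Proof.
move=> sE; apply: summing_boundP => // n x w _ w0 _.
rewrite mul0r (le_trans (@lnorm_le_const _ p n _ 0 p1 _)) ?mulr0// => i.
by rewrite rnorm0 normr0.
Qed.

Lemma summing_bound_domination E T S c b : subspace E -> 0 <= b ->
  (forall x, E x -> rnorm (S x) <= b * rnorm (T x)) -> summing_bound E T c ->
  summing_bound E S (b * c).
Proof.
move=> sE b0 ST Tc; apply: summing_boundP => // [|n x w xE w0 wE].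
  by case: Tc => c0 _; rewrite mulr_ge0.
apply: (@le_trans _ _ (lnorm p%:E (fun i => b * rnorm (T (x i))))).
  by apply: ler_lnorm => // i; rewrite !ger0_norm ?mulr_ge0 ?rnorm_ge0 ?ST.
rewrite lnormZ// ger0_norm// -mulrA ler_wpM2l//.
exact: summing_boundE Tc _ _.
Qed.

Lemma summing_bound_restrict E G T c : subspace E -> subspace G -> G `<=` E ->
  summing_bound E T c -> summing_bound G T c.
Proof.
move=> sE sG GE [c0 h]; split=> [|n x xG]; first exact: c0.
rewrite (le_trans (h _ _ (fun i => GE _ (xG i))))// lee_wpmul2l ?lee_fin//.
exact: weak_norm_sub.
Qed.

Lemma summing_bound_comp (Z : normedModType K) (G : set Z) E (Q : Z -> X) T c q :
  subspace E -> subspace G -> linear_on G Q -> (forall z, G z -> E (Q z)) -> 0 < q ->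
  (forall z, G z -> rnorm (Q z) <= q * rnorm z) ->
  summing_bound E T c -> summing_bound G (T \o Q) (c * q).
Proof.
move=> sE sG lQ QE q0 Qq [c0 h]; split=> [|n x xG]; first by rewrite mulr_ge0// ltW.
rewrite (le_trans (h n (Q \o x) (fun i => QE _ (xG i))))// EFinM -muleA.
by rewrite lee_wpmul2l ?lee_fin//; apply: weak_norm_comp.
Qed.

(** Since f / b lies in the dual ball, the l_r norm of the values of f is at most b times the weak
    norm, and r <= p makes the l_p norm smaller still. *)
Lemma summing_bound_rank1 E (f : X -> K) (y : Y) b : subspace E ->
  linear_on E (f : X -> K^o) -> 0 < b -> (forall x, E x -> rnorm (f x) <= b * rnorm x) ->
  summing_bound E (fun x => f x *: y) (b * rnorm y).
Proof.
move=> sE lf b0 fb; apply: summing_boundP => // [|n x w xE w0 wE].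
  by rewrite mulr_ge0 ?rnorm_ge0// ltW.
pose g x := (semb R s b^-1 : K) * f x.
have gb : dual_ball E (g : X -> K^o).
  apply/dual_ballP => //; split=> [a x1 y1 Gx Gy|z Ez].
    rewrite /g lf// mulrDr; congr (_ + _).
    by rewrite -[a *: _]/(a * _) -[in RHS]/(a * _) mulrCA.
  rewrite /g -[rnorm _]/(rnorm ((semb R s b^-1 : K) *: (f z : K^o))).
  by rewrite rnormZ_semb ger0_norm ?invr_ge0 ?(ltW b0)// mulrC ler_pdivrMr// mulrC fb.
have := lnorm_weak x gb; rewrite wE lee_fin => h.
have -> : (fun i => rnorm (f (x i) *: y)) = (fun i => (b * rnorm y) * rnorm (g (x i))).
  apply/funext => i; rewrite /g rnormM rnorm_semb ger0_norm ?invr_ge0 ?(ltW b0)//.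
  by rewrite rnormZ; field; rewrite gt_eqF.
rewrite lnormZ// ger0_norm ?mulr_ge0 ?(ltW b0) ?rnorm_ge0//.
apply: ler_wpM2l; first by rewrite mulr_ge0 ?(ltW b0) ?rnorm_ge0.
exact: le_trans (lnorm_antimono _ r1 rp) h.
Qed.

(** The condition involves finitely many vectors at a time, so pointwise convergence is enough: one
    index k serves all the x i. *)
Lemma summing_bound_lim E (Tn : nat -> X -> Y) T c : subspace E -> 0 <= c ->
  (forall k, summing_bound E (Tn k) c) ->
  (forall x, E x -> forall e, 0 < e -> exists N, forall k, (N <= k)%N -> rnorm (T x - Tn k x) <= e) ->
  summing_bound E T c.
Proof.
move=> sE c0 Tnc TnT; apply: summing_boundP => // n x w xE w0 wE.
apply/ler_addgt0Pr => e e0.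
pose d := e / n.+1%:R.
have d0 : 0 < d by rewrite divr_gt0.
have /choice[N hN] : forall i, exists N, forall k, (N <= k)%N -> rnorm (T (x i) - Tn k (x i)) <= d.
  by move=> i; exact: TnT.
pose k := \max_i N i.
apply: (@le_trans _ _ (lnorm p%:E (fun i => rnorm (Tn k (x i)) + rnorm (T (x i) - Tn k (x i))))).
  apply: ler_lnorm => // i; rewrite !ger0_norm ?addr_ge0 ?rnorm_ge0//.
  by rewrite -{1}(subrK (Tn k (x i)) (T (x i))) addrC rnormD.
apply: (le_trans (lnormD _ _ p1)); rewrite lerD//.
  exact: summing_boundE (Tnc k) _ _.
apply: (@le_trans _ _ (n%:R * d)).
  apply: lnorm_le_const => // i; rewrite ger0_norm ?rnorm_ge0//.
  by apply: hN; rewrite /k; exact: (leq_bigmax i).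
rewrite /d mulrA ler_pdivrMr// mulrC ler_wpM2l ?(ltW e0)//.
by rewrite ler_nat.
Qed.

Lemma summing_norm_le E T c : summing_bound E T c -> (summing_norm p%:E r E T <= c%:E)%E.
Proof.
move=> Tc; apply/lee_addgt0Pr => e e0; apply: ereal_inf_lbound.
exists (c + e) => //; split; first by case: Tc => c0 _; rewrite ltr_wpDl.
have ce : c <= c + e by rewrite lerDl ltW.
by case: (summing_bound_le ce Tc) => _; apply.
Qed.

Lemma summing_norm_ge E T b :
  (forall c, summing_bound E T c -> b <= c) -> (b%:E <= summing_norm p%:E r E T)%E.
Proof.
move=> h; apply: le_ereal_inf_tmp => _ [c [c0 hc] <-]; rewrite lee_fin h//.
by split; [exact: ltW|].
Qed.

End bounds.

End summing.

(** * Orthogonal projections *)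

(** Sylvester's identity. Both U M and M U are block triangular, with these two determinants, and
    det (U M) = det (M U). *)
Lemma det_add1_mulmxC (K : comNzRingType) m n (A : 'M[K]_(m, n)) (B : 'M[K]_(n, m)) :
  \det (1%:M + A *m B) = \det (1%:M + B *m A).
Proof.
pose M := block_mx 1%:M (- A) B 1%:M.
pose U : 'M[K]_(m + n) := block_mx 1%:M A 0 1%:M.
have UM : U *m M = block_mx (1%:M + A *m B) 0 B 1%:M.
  by rewrite mulmx_block !mul1mx !mulmx1 !mul0mx !add0r addNr.
have MU : M *m U = block_mx 1%:M 0 B (1%:M + B *m A).
  by rewrite mulmx_block !mul1mx !mulmx1 !mulmx0 !addr0 subrr [B *m A + _]addrC.
have := congr1 determinant UM; rewrite det_lblock det1 mulr1 => <-.
have := congr1 determinant MU; rewrite det_lblock det1 mul1r => <-.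
by rewrite !det_mulmx mulrC.
Qed.

(** In the rank factorisation of Q as [col_base Q] times [row_base Q], idempotence makes the product
    in the other order the identity of size rank Q, and Sylvester's identity reduces to that
    size. *)
Lemma det_idempotent (K : fieldType) n (Q : 'M[K]_n) c : Q *m Q = Q ->
  \det (1%:M + c *: Q) = (1 + c) ^+ \rank Q.
Proof.
move=> QQ.
have BA : row_base Q *m col_base Q = 1%:M.
  apply: (row_full_inj (col_base_full Q)).
  apply: (row_free_inj (row_base_free Q)).
  by rewrite mulmx1 mulmx_base mulmxA mulmx_base -mulmxA mulmx_base QQ.
rewrite -{1}(mulmx_base Q) scalemxAl det_add1_mulmxC -scalemxAr BA.
rewrite (_ : 1%:M + _ = (1 + c)%:M) ?det_scalar//.
by apply/matrixP => i j; rewrite !mxE; case: eqP; rewrite ?mulr1n ?mulr0n ?mulr0 ?addr0 ?mulr1.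
Qed.

Section orthogonal_projection.
Variables (R : realType) (s : scalar_kind).
Local Notation K := (scalar_field R s).

Definition adjmx m n (A : 'M[K]_(m, n)) : 'M[K]_(n, m) := (map_mx (sconj R s) A)^T.

Lemma adjmxM m n l (A : 'M[K]_(m, n)) (B : 'M[K]_(n, l)) :
  adjmx (A *m B) = adjmx B *m adjmx A.
Proof. by rewrite /adjmx map_mxM trmx_mul. Qed.

Lemma adjmxB m n (A B : 'M[K]_(m, n)) : adjmx (A - B) = adjmx A - adjmx B.
Proof. by rewrite /adjmx map_mxB linearB. Qed.

Lemma adjmxZ m n a (A : 'M[K]_(m, n)) : adjmx (semb R s a *: A) = semb R s a *: adjmx A.
Proof. by rewrite /adjmx map_mxZ sconj_semb linearZ. Qed.

Lemma adjmx1 n : adjmx (1%:M : 'M[K]_n) = 1%:M.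
Proof. by rewrite /adjmx map_mx1 trmx1. Qed.

Lemma adjmxK m n (A : 'M[K]_(m, n)) : adjmx (adjmx A) = A.
Proof. by apply/matrixP => i j; rewrite !mxE sconjK. Qed.

Lemma l2norm_ge0 n (a : 'rV[K]_n) : 0 <= l2norm a.
Proof. exact: sqrtr_ge0. Qed.

Lemma l2norm_sqr n (a : 'rV[K]_n) : l2norm a ^+ 2 = \sum_i rnorm (a 0 i) ^+ 2.
Proof. by rewrite sqr_sqrtr// sumr_ge0// => i _; exact: sqr_ge0. Qed.

Lemma mul_adjmx n (a : 'rV[K]_n) : a *m adjmx a = (semb R s (l2norm a ^+ 2))%:M.
Proof.
apply/matrixP => i j; rewrite !ord1 !mxE mulr1n l2norm_sqr rmorph_sum.
by apply: eq_bigr => l _; rewrite !mxE mul_sconj.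
Qed.

Lemma l2norm_eq0 n (a : 'rV[K]_n) : l2norm a = 0 -> a = 0.
Proof.
move=> a0; have := l2norm_sqr a; rewrite a0 expr0n /= => /esym/eqP.
rewrite psumr_eq0; last by move=> i _; exact: sqr_ge0.
move=> /allP h; apply/rowP => i; rewrite mxE.
by have := h i (mem_index_enum _); rewrite sqrf_eq0 => /eqP/rnorm0_eq0.
Qed.

(** Pythagoras: the squares of the norms of a Q and a (1 - Q) add up to that of a. *)
Lemma l2norm_proj n (Q : 'M[K]_n) a : Q *m Q = Q -> adjmx Q = Q ->
  l2norm (a *m Q) <= l2norm a.
Proof.
move=> QQ Qa; rewrite -(@ler_pXn2r _ 2)// ?nnegrE ?l2norm_ge0//.
suff -> : l2norm a ^+ 2 = l2norm (a *m Q) ^+ 2 + l2norm (a *m (1%:M - Q)) ^+ 2.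
  by rewrite lerDl sqr_ge0.
apply: (can_inj (@sembK R s)); rewrite rmorphD.
have inj (x y : K) : x%:M = y%:M :> 'M[K]_1 -> x = y.
  by move/matrixP => /(_ 0 0); rewrite !mxE !mulr1n.
apply: inj; rewrite raddfD /= -!mul_adjmx !adjmxM adjmxB adjmx1 Qa.
rewrite !mulmxA -[a *m Q *m Q]mulmxA QQ.
have PP : (1%:M - Q) *m (1%:M - Q) = 1%:M - Q.
  by rewrite mulmxBr mulmx1 mulmxBl mul1mx QQ subrr subr0.
rewrite -[a *m _ *m (1%:M - Q)]mulmxA PP.
by rewrite -mulmxDl -mulmxDr addrC subrK mulmx1.
Qed.

(** Gram-Schmidt on the columns of B. Matrices act on row vectors from the right, so Q B = 0 says
    that the range of Q lies in the kernel of z |-> z B. *)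
Lemma orthogonal_projection_exists n k (B : 'M[K]_(n, k)) :
  exists Q : 'M[K]_n, [/\ Q *m Q = Q, adjmx Q = Q, Q *m B = 0 & (n <= \rank Q + k)%N].
Proof.
elim: k B => [|k IH] B.
  exists 1%:M; split; rewrite ?mulmx1 ?adjmx1 ?mxrank1 ?addn0//.
  by apply/matrixP => i [].
pose b := lsubmx (B : 'M[K]_(n, 1 + k)); pose B' := rsubmx (B : 'M[K]_(n, 1 + k)).
have mulB (M : 'M[K]_n) : M *m B = row_mx (M *m b) (M *m B').
  have BE : B = row_mx b B' by rewrite hsubmxK.
  by rewrite {1}BE; exact: (@mul_mx_row K n n 1 k M b B').
have [Q [QQ Qa QB rQ]] := IH B'.
have [c0|c0] := eqVneq (Q *m b) 0.
  exists Q; split=> //; last by rewrite addnS leqW.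
  by rewrite mulB c0 QB; exact: (@row_mx0 _ n 1 k).
(* If c = Q b is nonzero, the rank one projection P = c c^* / |c|^2 is subtracted from Q, which
   costs one dimension for the column b. *)
move cE : (Q *m b) c0 => c c0; pose nu := l2norm (adjmx c) ^+ 2.
have nu0 : nu != 0.
  rewrite sqrf_eq0; apply: contra c0 => /eqP/l2norm_eq0 h.
  by rewrite -(adjmxK c) h; apply/eqP/matrixP => i j; rewrite !mxE rmorph0.
have cc : adjmx c *m c = (semb R s nu)%:M.
  by rewrite -mul_adjmx adjmxK.
have Qc : Q *m c = c by rewrite -cE mulmxA QQ.
have cQ : adjmx c *m Q = adjmx c by rewrite -{1}Qa -adjmxM Qc.
have cb : adjmx c *m b = (semb R s nu)%:M by rewrite -cc -{1}cQ -mulmxA cE.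
have cB : adjmx c *m B' = 0 by rewrite -cQ -mulmxA QB mulmx0.
pose P := semb R s nu^-1 *: (c *m adjmx c).
have nuV : semb R s nu^-1 * semb R s nu = 1 by rewrite -rmorphM mulVf ?rmorph1.
have QP : Q *m P = P by rewrite -scalemxAr mulmxA Qc.
have PQ : P *m Q = P by rewrite -scalemxAl -mulmxA cQ.
have PP : P *m P = P.
  rewrite -{1}/P /P -scalemxAl -scalemxAr mulmxA -[c *m _ *m c]mulmxA cc.
  by rewrite mul_mx_scalar -scalemxAl [X in _ *: X]scalerA nuV scale1r.
exists (Q - P); split.
- by rewrite mulmxBl !mulmxBr QQ QP PQ PP subrr subr0.
- by rewrite adjmxB Qa /P adjmxZ adjmxM adjmxK.
- rewrite mulB mulmxBl mulmxBl QB cE /P -!scalemxAl -!mulmxA cb cB.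
  rewrite mulmx0 scaler0 subr0 (mul_mx_scalar _ c) scalerA nuV scale1r subrr.
  exact: (@row_mx0 _ n 1 k).
- have rP : (\rank P <= 1)%N.
    by rewrite /P scalemxAl (leq_trans (mxrankM_maxr _ _))// rank_leq_row.
  have : (\rank Q <= \rank (Q - P)%R + \rank P)%N.
    by rewrite -{1}(subrK P Q) mxrank_add.
  move: rQ rP; lia.
Qed.

End orthogonal_projection.

(** * The Hahn-Banach theorem *)

Section hahn_banach.
Variables (R : realType) (s : scalar_kind).
Local Notation K := (scalar_field R s).

Section real_form.
Variables (X : normedModType K) (x0 : X).
Local Notation "a ^*: x" := (semb R s a *: (x : X)) (at level 40).

Let sD a b x : (a + b) ^*: x = a ^*: x + b ^*: x.
Proof. by rewrite rmorphD scalerDl. Qed.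

Let sA a b x : a ^*: (b ^*: x) = (a * b) ^*: x.
Proof. by rewrite scalerA rmorphM. Qed.

Let s1 x : 1 ^*: x = x.
Proof. by rewrite rmorph1 scale1r. Qed.

(* Graphs of partially defined functionals: domination by the norm makes
   such a graph single-valued. *)
Let dominated_graph (G : set (X * R)) :=
  [/\ forall a u v, G u -> G v -> G (a ^*: u.1 + v.1, a * u.2 + v.2),
      forall u, G u -> u.2 <= rnorm u.1 & G (x0, rnorm x0)].

Let dominated_graph0 G : dominated_graph G -> G (0, 0).
Proof.
move=> [Gl _ G0]; have := Gl (-1) _ _ G0 G0.
by rewrite /= rmorphN rmorph1 scaleN1r mulN1r !addNr.
Qed.

Let dominated_graphZ G a u : dominated_graph G -> G u -> G (a ^*: u.1, a * u.2).
Proof.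
move=> gG Gu; have [Gl _ _] := gG; have := Gl a _ _ Gu (dominated_graph0 gG).
by rewrite /= !addr0.
Qed.

(** The value c at y has to lie between all u.2 - |u.1 - y| and all |v.1 + y| - v.2; [Sub], a
    triangle inequality, shows that the supremum of the former qualifies. Domination at u.1 + t y
    then follows by dividing by |t|, with [cle] for t > 0 and [cge] for t < 0. *)
Let dominated_graph_extend G y : dominated_graph G ->
  exists2 G', dominated_graph G' & G `<=` G' /\ exists c, G' (y, c).
Proof.
move=> gG; have [Gl Gd G0] := gG.
pose S := [set u.2 - rnorm (u.1 - y) | u in G].
have Sub u v : G u -> G v -> u.2 - rnorm (u.1 - y) <= rnorm (v.1 + y) - v.2.
  move=> Gu Gv; rewrite lerBlDr addrAC lerBrDr.
  have := Gd _ (Gl 1 _ _ Gu Gv); rewrite /= s1 mul1r => /le_trans; apply.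
  have -> : u.1 + v.1 = (v.1 + y) + (u.1 - y).
    by rewrite -addrA [y + _]addrC subrK addrC.
  exact: rnormD.
have S0 : S !=set0 by exists (rnorm x0 - rnorm (x0 - y)); exists (x0, rnorm x0).
pose c := sup S.
have cge u : G u -> u.2 - rnorm (u.1 - y) <= c.
  move=> Gu; apply: ub_le_sup; last by exists u.
  by exists (rnorm (x0 + y) - rnorm x0) => _ [w Gw <-]; exact: (Sub w (x0, rnorm x0)).
have cle u : G u -> c <= rnorm (u.1 + y) - u.2.
  by move=> Gu; apply: ge_sup => // _ [w Gw <-]; exact: Sub.
pose G' : set (X * R) := [set w | exists t u, G u /\ w = (u.1 + t ^*: y, u.2 + t * c)].
exists G'; last first.
  split=> [u Gu|]; first by exists 0, u; rewrite rmorph0 scale0r mul0r !addr0 -surjective_pairing.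
  exists c, 1, (0, 0); split; first exact: dominated_graph0.
  by rewrite /= s1 mul1r !add0r.
split.
- move=> a _ _ [t [u [Gu ->]]] [t' [v [Gv ->]]] /=.
  exists (a * t + t'), (a ^*: u.1 + v.1, a * u.2 + v.2); split; first exact: Gl.
  rewrite /= scalerDr sA sD !addrA; congr (_, _); last by ring.
  by rewrite -!addrA; congr (_ + _); rewrite !addrA; congr (_ + _); rewrite addrC.
- move=> _ [t [u [Gu ->]]] /=.
  have [t0|t0|->] := ltgtP t 0; last first.
  + by rewrite rmorph0 scale0r mul0r !addr0; exact: Gd.
  + have := cle _ (dominated_graphZ t^-1 gG Gu); rewrite /= lerBrDr.
    rewrite -(ler_pM2l t0) mulrDr mulrA mulfV ?gt_eqF// mul1r addrC.
    move=> /le_trans; apply; rewrite -{1}(gtr0_norm t0) -rnormZ_semb scalerDr sA.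
    by rewrite mulfV ?gt_eqF// s1.
  + have nt0 : 0 < - t by rewrite oppr_gt0.
    have := cge _ (dominated_graphZ (- t)^-1 gG Gu); rewrite /= lerBlDr.
    rewrite -(ler_pM2l nt0) mulrDr mulrA mulfV ?gt_eqF// mul1r mulNr.
    rewrite addrC -lerBlDr opprK => /le_trans; apply.
    rewrite -{1}(gtr0_norm nt0) -rnormZ_semb scalerBr sA mulfV ?gt_eqF// s1.
    by rewrite rmorphN scaleNr opprK.
- by exists 0, (x0, rnorm x0); rewrite /= rmorph0 scale0r mul0r !addr0.
Qed.

Lemma hahn_banach_real : exists g : X -> R,
  [/\ forall a x y, g (a ^*: x + y) = a * g x + g y,
      forall x, g x <= rnorm x & g x0 = rnorm x0].
Proof.
pose P G := G = set0 \/ dominated_graph G.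
have [F FP totF|G [PG maxG]] := @Zorn_bigcup _ P.
  have [[G0 FG0 gG0]|nF] := pselect (exists2 G, F G & dominated_graph G); last first.
    left; apply/seteqP; split=> // u [G FG Gu].
    by have [G0|gG] := FP _ FG; [rewrite -G0|case: nF; exists G].
  have FE G u : F G -> G u -> dominated_graph G.
    by move=> FG Gu; have [E|//] := FP _ FG; rewrite E in Gu.
  right; split.
  - move=> a u v [G1 FG1 G1u] [G2 FG2 G2v].
    have [G12|G21] := totF _ _ FG1 FG2.
      by exists G2 => //; have [Gl _ _] := FE _ _ FG2 G2v; apply: Gl => //; exact: G12.
    by exists G1 => //; have [Gl _ _] := FE _ _ FG1 G1u; apply: Gl => //; exact: G21.
  - by move=> u [G FG Gu]; have [_ Gd _] := FE _ _ FG Gu; exact: Gd.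
  - by exists G0 => //; case: gG0.
have gG : dominated_graph G.
  have [G0|//] := PG.
  pose L : set (X * R) := [set (t ^*: x0, t * rnorm x0) | t in setT].
  have gL : dominated_graph L.
    split.
    - move=> a _ _ [t _ <-] [t' _ <-] /=; exists (a * t + t') => //.
      by rewrite sD -sA; congr (_, _); ring.
    - move=> _ [t _ <-] /=; rewrite rnormZ_semb.
      by rewrite ler_wpM2r ?rnorm_ge0 ?ler_norm.
    - by exists 1 => //; rewrite s1 mul1r.
  exfalso; apply: (maxG L); last by right.
  by rewrite G0 properEneq; split=> //; apply/eqP => E; case: gL => _ _; rewrite -E.
have [Gl Gd G0] := gG.
have /choice[g gE] : forall y, exists c, G (y, c).
  move=> y; have [G' gG' [GG' [c G'c]]] := dominated_graph_extend y gG.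
  have [E|/eqP nE] := pselect (G = G'); first by exists c; rewrite E.
  by exfalso; apply: (maxG G'); [rewrite properEneq; split|right].
have Gu x a : G (x, a) -> g x = a.
  move=> Ga; apply/eqP; rewrite eq_le; apply/andP; split; rewrite -subr_le0.
    have := Gd _ (Gl (-1) _ _ Ga (gE x)).
    by rewrite /= rmorphN rmorph1 scaleN1r addNr rnorm0 mulN1r addrC.
  have := Gd _ (Gl (-1) _ _ (gE x) Ga).
  by rewrite /= rmorphN rmorph1 scaleN1r addNr rnorm0 mulN1r addrC.
exists g; split=> [a x y|x|]; last exact: Gu.
  by apply: Gu; exact: (Gl a _ _ (gE x) (gE y)).
exact: (Gd _ (gE x)).
Qed.

End real_form.
End hahn_banach.

Lemma rnorm_le_scalar_re (R : realType) (s : scalar_kind) (z : scalar_field R s) :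
  rnorm z <= scalar_re z -> z = semb R s (scalar_re z).
Proof.
rewrite /semb; case: s z => [//|[a b]].
rewrite /rnorm normc_def /= => ab.
have a0 : 0 <= a by rewrite (le_trans _ ab)// sqrtr_ge0.
move: ab; rewrite -(@ler_pXn2r _ 2)// ?nnegrE ?sqrtr_ge0//.
rewrite sqr_sqrtr ?addr_ge0 ?sqr_ge0// gerDl => b0.
have /eqP : b ^+ 2 == 0 by rewrite eq_le b0 sqr_ge0.
by move=> /eqP; rewrite sqrf_eq0 => /eqP ->.
Qed.

(** In the complex case f x = g x - i g (i x). *)
Lemma real_part_functional (R : realType) (s : scalar_kind)
    (X : normedModType (scalar_field R s)) (g : X -> R) :
  (forall a x y, g (semb R s a *: x + y) = a * g x + g y) ->
  exists f : {linear X -> (scalar_field R s)^o}, forall x, scalar_re (f x) = g x.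
Proof.
case: s X g => X g gl.
  have [|f fE] := @linearP_exists R X R^o g; first by move=> a x y; exact: gl.
  by exists f => x; rewrite -fE.
pose h (x : X) : R[i] := (g x +i* (- g ('i%C *: x)))%C.
have g00 : g 0 = 0.
  by have := gl (-1) 0 0; rewrite scaler0 addr0 mulN1r addNr.
have gD x y : g (x + y) = g x + g y.
  by have := gl 1 x y; rewrite rmorph1 scale1r mul1r.
have gZ a x : g (a%:C%C *: x) = a * g x.
  by have := gl a x 0; rewrite g00 !addr0.
have hl : linear (h : X -> R[i]^o).
  move=> a x y; rewrite /h.
  have aE : a = ((complex.Re a)%:C + 'i * (complex.Im a)%:C)%C by rewrite -complexE.
  have gN z : g (- z) = - g z.
    by have := gZ (-1) z; rewrite rmorphN rmorph1 scaleN1r mulN1r.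
  have ga z : g (a *: z) = complex.Re a * g z + complex.Im a * g ('i%C *: z).
    by rewrite {1}aE scalerDl gD gZ ['i%C * _]mulrC -scalerA gZ.
  have gia z : g ('i%C *: (a *: z)) = complex.Re a * g ('i%C *: z) - complex.Im a * g z.
    by rewrite scalerA mulrC -scalerA ga scalerA -expr2 sqr_i scaleN1r gN mulrN.
  rewrite scalerDr !gD ga gia.
  rewrite -[a *: _]/(a * _); clear; case: a => p q /=.
  apply/eqP; rewrite eq_complex /=; apply/andP; split; apply/eqP; ring.
have [f fE] := linearP_exists hl.
by exists f => x; rewrite fE.
Qed.

Lemma norming_functional (R : realType) (s : scalar_kind)
    (X : normedModType (scalar_field R s)) (x0 : X) :
  exists f : {linear X -> (scalar_field R s)^o},
    (forall x, rnorm (f x : scalar_field R s) <= rnorm x) /\ f x0 = semb R s (rnorm x0).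
Proof.
have [g [gl gd g0]] := hahn_banach_real x0.
have [f fg] := real_part_functional gl.
have fn x : rnorm (f x : scalar_field R s) <= rnorm x.
  have [->|fx0] := eqVneq (f x : scalar_field R s) 0; first by rewrite rnorm0 rnorm_ge0.
  have n0 : 0 < rnorm (f x : scalar_field R s) by rewrite rnorm_gt0.
  set N := rnorm _ in n0 *.
  (* A rotation: u has modulus 1 and f (u x) = |f x| is real, hence equal to g (u x). *)
  pose u := sconj R s (f x) * semb R s N^-1.
  have fu : f (u *: x) = semb R s N.
    rewrite linearZ -[LHS]/(u * f x) /u mulrAC [sconj R s _ * _]mulrC mul_sconj -/N.
    by rewrite -rmorphM expr2 mulfK// gt_eqF.
  have nu : rnorm u = 1.
    rewrite /u rnormM rnorm_sconj rnorm_semb -/N ger0_norm ?invr_ge0 ?ltW//.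
    by rewrite mulfV// gt_eqF.
  by have := gd (u *: x); rewrite rnormZ nu mul1r -fg fu sembK.
exists f; split=> //; rewrite -g0 -fg; apply: rnorm_le_scalar_re.
by rewrite fg g0 fn.
Qed.

(** * Closed subspaces of finite codimension *)

Section cofinite.
Variables (R : realType) (s : scalar_kind).
Local Notation K := (scalar_field R s).

Lemma bounded_opP (V W : normedModType K) (u : {linear V -> W}) :
  bounded_op u <-> exists M, forall x, rnorm (u x) <= M * rnorm x.
Proof.
split=> [/linear_boundedP /pinfty_ex_gt0 [M M0 hM]|[M hM]].
  exists (scalar_re M) => x.
  by rewrite -(semb_le s) rmorphM (scalar_re_ge0 (ltW M0)) -!normE.
apply/linear_boundedP; exists (semb R s `|M|); split.
  by apply: ger0_real; rewrite -(rmorph0 (semb R s)) semb_le.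
move=> r Mr x; apply: (@le_trans _ _ (semb R s `|M| * `|x|)); last first.
  by rewrite ler_wpM2r// ltW.
rewrite !normE -rmorphM semb_le (le_trans (hM x))//.
by rewrite ler_wpM2r ?rnorm_ge0 ?ler_norm.
Qed.

Lemma closed_ker (V W : normedModType K) (u : {linear V -> W}) :
  bounded_op u -> closed [set x | u x = 0].
Proof.
move=> /bounded_linear_continuous uc.
rewrite -[X in closed X]/(u @^-1` [set 0]).
apply: closed_comp => [x _|]; first exact: uc.
exact: accessible_closed_set1 (@hausdorff_accessible _ (@norm_hausdorff _ _)) _.
Qed.

(* A closed subspace of finite codimension, as the kernel of finitely many
   bounded functionals. *)
Definition cofinite (X : normedModType K) (E : set X) :=
  exists N (phi : {linear X -> 'rV[K]_N}) M,
    (forall x i, rnorm (phi x 0 i) <= M * rnorm x) /\ E = [set x | phi x = 0].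

Section cofinite_theory.
Variable X : normedModType K.
Implicit Types E : set X.

Lemma cofiniteP (I : finType) (f : I -> {linear X -> K^o}) M :
  (forall x i, rnorm (f i x : K) <= M * rnorm x) -> cofinite [set x | forall i, f i x = 0].
Proof.
move=> fM.
have [|phi phiE] := @linearP_exists K X 'rV[K]_(#|I|) (fun x => \row_i f (enum_val i) x).
  by move=> a x y; apply/rowP => i; rewrite !mxE linearP.
exists _, phi, M; split=> [x i|]; first by rewrite phiE mxE.
apply/seteqP; split=> x /= h; first by apply/rowP => i; rewrite phiE !mxE.
move=> i; have /rowP/(_ (enum_rank i)) := h.
by rewrite phiE !mxE enum_rankK.
Qed.

Lemma cofiniteT : cofinite [set: X].
Proof.
rewrite (_ : setT = [set x : X | forall i : 'I_0, (\0 : {linear X -> K^o}) x = 0]).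
  by apply: (@cofiniteP _ _ 0) => x [].
by apply/seteqP; split=> // x _ [].
Qed.

Lemma cofiniteI E F : cofinite E -> cofinite F -> cofinite (E `&` F).
Proof.
move=> [N [phi [M [hM ->]]]] [N' [phi' [M' [hM' ->]]]].
have [|psi psiE] := @linearP_exists K X 'rV[K]_(N + N') (fun x => row_mx (phi x) (phi' x)).
  by move=> a x y; rewrite !linearP scale_row_mx add_row_mx.
exists _, psi, (Num.max M M'); split=> [x i|].
  rewrite psiE mxE; case: fintype.split => j.
    by rewrite (le_trans (hM _ _))// ler_wpM2r ?rnorm_ge0// le_max lexx.
  by rewrite (le_trans (hM' _ _))// ler_wpM2r ?rnorm_ge0// le_max lexx orbT.
apply/seteqP; split=> x /=; first by move=> [p0 p'0]; rewrite psiE p0 p'0 row_mx0.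
by rewrite psiE -[0]row_mx0 => /eq_row_mx.
Qed.

Lemma cofinite_subspace E : cofinite E -> subspace E.
Proof. by move=> [N [phi [M [_ ->]]]]; exact: subspace_ker. Qed.

Lemma cofinite_closed E : cofinite E -> closed E.
Proof.
move=> [N [phi [M [hM ->]]]].
have lf i : exists f : {linear X -> K^o}, forall x, f x = phi x 0 i.
  by apply: (@linearP_exists K X K^o) => a x y; rewrite linearP !mxE.
have /choice[f fE] := lf.
rewrite (_ : mkset _ = \bigcap_i [set x | f i x = 0]).
  apply: closed_bigI => i _; apply: closed_ker; apply/bounded_opP.
  by exists M => x; rewrite fE; exact: hM.
apply/seteqP; split=> x /= h; first by move=> i _ /=; rewrite fE h mxE.
by apply/rowP => i; rewrite mxE -fE; exact: h.
Qed.

Lemma cofinite_codim E : cofinite E -> exists k, has_codim E k.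
Proof.
move=> [N [phi [M [_ ->]]]].
have [x|k _ h] := @finite_rank_has_dim _ _ _ phi N (fun i => delta_mx 0 i).
  by exists (phi x); rewrite /lincomb -row_sum_delta.
by exists k; exact: has_codim_ker.
Qed.

Lemma cofinite_neq0 E : infinite_dim X -> cofinite E -> exists2 x, x != 0 & E x.
Proof.
move=> hX [N [phi [M [_ ->]]]].
by have [x x0 px] := infinite_dim_ker phi hX; exists x.
Qed.

(** The new vector z is chosen in the kernels of the previous functionals, and f norms z. Placed
    first, z contributes a row whose only nonzero entry is f z, so the determinant is f z times the
    previous one. *)
Lemma independent_functionals n E : infinite_dim X -> cofinite E ->
  exists (y : 'I_n -> X) (g : 'I_n -> {linear X -> K^o}),
    [/\ forall l, E (y l), forall i x, rnorm (g i x : K) <= rnorm x &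
        \det (\matrix_(l, i) (g i (y l) : K)) != 0].
Proof.
move=> hX cE; elim: n => [|n [y [g [yE g1 d0]]]].
  exists (fun=> 0), (fun=> \0); split=> [[]//|[]//|]; by rewrite det_mx00 oner_neq0.
have cE' : cofinite (E `&` [set x | forall i, g i x = 0]).
  by apply: cofiniteI => //; apply: (@cofiniteP _ _ 1) => x i; rewrite mul1r.
have [z z0 [Ez gz]] := cofinite_neq0 hX cE'.
have [f [f1 fz]] := norming_functional z.
exists (fun i => if unlift ord0 i is Some j then y j else z).
exists (fun i => if unlift ord0 i is Some j then g j else f).
split=> [l|i x|]; [by case: unliftP|by case: unliftP|].
rewrite (expand_det_row _ ord0) big_ord_recl big1 ?addr0; last first.
  by move=> j _; rewrite mxE unlift_none liftK gz mul0r.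
rewrite mxE unlift_none mulf_neq0//.
  by rewrite fz -(rmorph0 (semb R s)) (inj_eq (can_inj (@sembK R s))) gt_eqF ?rnorm_gt0.
rewrite /cofactor expr0 mul1r.
apply: contra_neq d0 => <-; congr (\det _).
by apply/matrixP => l i; rewrite !mxE !liftK.
Qed.

(** The row of values g i (lincomb y a) is a M, so a is recovered by multiplying with the inverse of
    M. *)
Lemma coordinates_bounded n (y : 'I_n -> X) (g : 'I_n -> {linear X -> K^o}) :
  (forall i x, rnorm (g i x : K) <= rnorm x) ->
  \det (\matrix_(l, i) (g i (y l) : K)) != 0 ->
  exists A, forall (a : 'rV[K]_n) l, rnorm (a 0 l) <= A * rnorm (lincomb y a).
Proof.
move=> g1 d0; set M := \matrix_(l, i) _ in d0.
exists (\sum_i \sum_l rnorm (invmx M i l)) => a l.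
have aM : a *m M = \row_i (g i (lincomb y a) : K).
  by apply/rowP => i; rewrite !mxE lincomb_linear /lincomb; apply: eq_bigr => j _; rewrite !mxE.
have aE : a = (\row_i (g i (lincomb y a) : K)) *m invmx M.
  by rewrite -aM mulmxK// unitmxE unitfE.
have -> : a 0 l = \sum_i (g i (lincomb y a) : K) * invmx M i l.
  by rewrite {1}aE mxE; apply: eq_bigr => i _; rewrite mxE.
rewrite (le_trans (rnorm_sum _ _ _))// mulr_suml; apply: ler_sum => i _.
rewrite rnormM mulrC; apply: ler_pM; rewrite ?rnorm_ge0 ?g1//.
by rewrite (bigD1 l)//= lerDl sumr_ge0// => j _; exact: rnorm_ge0.
Qed.

End cofinite_theory.
End cofinite.

(** * Finite nets of scalars and Mazur's argument *)

Lemma real_net (R : realType) (A e : R) : 0 < e ->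
  exists N (c : 'I_N -> R), forall x, `|x| <= A -> exists i, `|x - c i| <= e.
Proof.
move=> e0; pose N := (Num.truncn (2 * A / e)).+1.
exists N, (fun i => - A + i%:R * e) => x; rewrite ler_norml => /andP[Ax xA].
have xA0 : 0 <= (x + A) / e by rewrite divr_ge0 ?(ltW e0)// -lerBlDr sub0r.
have /andP[k1 k2] := Num.Theory.truncn_itv xA0.
set k := Num.truncn _ in k1 k2.
have kN : (k < N)%N.
  rewrite ltnS /k /N Num.Theory.le_truncn// ler_wpM2r ?invr_ge0 ?(ltW e0)//.
  by rewrite mulr_natl mulr2n lerD2r.
exists (Ordinal kN) => /=.
have -> : x - (- A + k%:R * e) = ((x + A) / e - k%:R) * e by field; rewrite gt_eqF.
rewrite normrM (gtr0_norm e0) ger_pMl// ger0_norm ?subr_ge0//.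
by rewrite lerBlDr nat1r ltW.
Qed.

Lemma scalar_net (R : realType) (s : scalar_kind) (A e : R) : 0 < e ->
  exists (I : finType) (c : I -> scalar_field R s), forall z, rnorm z <= A ->
    exists i, rnorm (z - c i) <= e.
Proof.
move=> e0; case: s; first by have [N [c hc]] := real_net A e0; exists 'I_N, c.
have e20 : 0 < e / 2 by rewrite divr_gt0.
have [N [c hc]] := real_net A e20.
exists ('I_N * 'I_N)%type, (fun i => (c i.1 +i* c i.2)%C) => -[a b].
rewrite /rnorm normc_def /= => ab.
have h (u v : R) : `|u| <= Num.sqrt (u ^+ 2 + v ^+ 2).
  by rewrite -sqrtr_sqr ler_wsqrtr// lerDl sqr_ge0.
have [i hi] := hc a (le_trans (h _ _) ab).
have [j hj] : exists j, `|b - c j| <= e / 2.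
  by apply: hc; apply: le_trans ab; rewrite addrC h.
exists (i, j); rewrite /=.
rewrite -(@ler_pXn2r _ 2)// ?nnegrE ?sqrtr_ge0 ?(ltW e0)//.
rewrite sqr_sqrtr ?addr_ge0 ?sqr_ge0//.
have sq (u : R) : `|u| <= e / 2 -> u ^+ 2 <= (e / 2) ^+ 2.
  by move=> ue; rewrite -real_normK ?num_real// lerXn2r ?nnegrE ?normr_ge0// ltW.
apply: (le_trans (lerD (sq _ hi) (sq _ hj))).
by have := sqr_ge0 e; lra.
Qed.

Section mazur.
Variables (R : realType) (s : scalar_kind).
Local Notation K := (scalar_field R s).
Variable X : normedModType K.

(** The net is taken on the coefficients, which are at most A for unit vectors, and e makes the
    vectors [yc i] 1/4-dense among the unit vectors. If f norms a net point within 1/4 of a unit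
    vector y and f z = 0, then |y + z| >= |f y| >= 3/4 - 1/4 = 1/2. *)
Lemma mazur_cofinite n (y : 'I_n -> X) A :
  (forall (a : 'rV[K]_n) l, rnorm (a 0 l) <= A * rnorm (lincomb y a)) ->
  exists2 E : set X, cofinite E &
    forall a z, E z -> rnorm (lincomb y a) <= 2 * rnorm (lincomb y a + z).
Proof.
move=> yA.
pose W := \sum_l rnorm (y l) + 1.
have W0 : 0 < W by rewrite ltr_wpDl// sumr_ge0// => l _; exact: rnorm_ge0.
pose e := (4 * W)^-1.
have e0 : 0 < e by rewrite invr_gt0 mulr_gt0.
have [I [c hc]] := scalar_net s A e0.
pose yc (i : {ffun 'I_n -> I}) := lincomb y (\row_l c (i l)).
have /choice[f hf] := fun i => norming_functional (yc i).
exists [set x | forall i, f i x = 0].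
  by apply: (@cofiniteP _ _ _ _ _ 1) => x i; rewrite mul1r; case: (hf i).
have unit a z : rnorm (lincomb y a) = 1 -> (forall i, f i z = 0) ->
    1 <= 2 * rnorm (lincomb y a + z).
  move=> a1 fz.
  have /choice[i hi] : forall l, exists i, rnorm (a 0 l - c i) <= e.
    by move=> l; apply: hc; rewrite (le_trans (yA _ _))// a1 mulr1.
  pose i' := [ffun l => i l]; have [f1 fy] := hf i'.
  have ay : rnorm (lincomb y a - yc i') <= 4^-1.
    rewrite -linearB /lincomb (le_trans (rnorm_sum _ _ _))//.
    apply: (@le_trans _ _ (e * \sum_l rnorm (y l))).
      rewrite mulr_sumr; apply: ler_sum => l _.
      by rewrite rnormZ !mxE ffunE ler_wpM2r ?rnorm_ge0.
    by rewrite /e invfM -mulrA ger_pMr// mulrC ler_pdivrMr// mul1r /W lerDl.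
  have yc1 : 1 - 4^-1 <= rnorm (yc i').
    have := rnormD (yc i') (lincomb y a - yc i').
    by rewrite addrC subrK a1 lerBlDr => /le_trans; apply; rewrite lerD2l.
  have : rnorm (f i' (lincomb y a) : K) <= rnorm (lincomb y a + z).
    by have := f1 (lincomb y a + z); rewrite linearD fz addr0.
  have : rnorm (yc i') <= rnorm (f i' (lincomb y a) : K) + 4^-1.
    have := rnormD (f i' (lincomb y a) : K) (f i' (yc i' - lincomb y a)).
    rewrite -[X in rnorm X <= _]linearD [_ + (_ - _)]addrC subrK fy rnorm_semb.
    rewrite ger0_norm ?rnorm_ge0// => /le_trans; apply.
    by rewrite lerD2l (le_trans (f1 _))// -rnormN opprB.
  lra.
move=> a z fz.
have [->|a0] := eqVneq (lincomb y a) 0; first by rewrite rnorm0 mulr_ge0 ?rnorm_ge0.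
have N0 : 0 < rnorm (lincomb y a) by rewrite rnorm_gt0.
set N := rnorm (lincomb y a) in N0 *.
have := unit (semb R s N^-1 *: a) (semb R s N^-1 *: z).
rewrite linearZ -scalerDr !rnormZ_semb gtr0_norm ?invr_gt0// mulVf ?gt_eqF//.
move=> /(_ erefl) h; have {h} : 1 <= 2 * (N^-1 * rnorm (lincomb y a + z)).
  by apply: h => i; rewrite linearZ /= fz scaler0.
by rewrite mulrCA mulrC ler_pdivlMr// mul1r.
Qed.

End mazur.

(** * Blocks *)

Section hilbertian_block.
Variables (R : realType) (s : scalar_kind).
Local Notation K := (scalar_field R s).

Lemma l2normZ n (c : R) (a : 'rV[K]_n) : l2norm (semb R s c *: a) = `|c| * l2norm a.
Proof.
rewrite /l2norm -sqrtr_sqr -sqrtrM ?sqr_ge0//; congr Num.sqrt.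
rewrite mulr_sumr; apply: eq_bigr => i _.
by rewrite mxE rnormM rnorm_semb exprMn real_normK ?num_real.
Qed.

Lemma rnorm_le_l2norm n (a : 'rV[K]_n) i : rnorm (a 0 i) <= l2norm a.
Proof.
rewrite -(@ler_pXn2r _ 2)// ?nnegrE ?rnorm_ge0 ?l2norm_ge0// l2norm_sqr.
by rewrite (bigD1 i)//= lerDl sumr_ge0// => j _; exact: sqr_ge0.
Qed.

Lemma opnorm_ge0 (V W : lmodType K) (NV : V -> R) (NW : W -> R) (E : set V) (f : V -> W) :
  NV 0 = 0 -> (forall y, 0 <= NW y) -> E 0 -> (0 <= opnorm NV NW E f)%E.
Proof.
move=> NV0 NW0 E0; apply: (@le_trans _ _ (NW (f 0))%:E); first by rewrite lee_fin.
by apply: ereal_sup_ubound; exists 0 => //; split=> //; rewrite NV0.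
Qed.

(** Here psi = u o P with u an isomorphism from E to l_2^n and P the projection onto E, so that v o
    psi = P. The product a b is only brought below 2 C because the infimum defining the distance
    need not be attained. *)
Lemma hilbertian_block (X : normedModType K) C n (X' : set X) :
  1 < C -> property_P X C -> (0 < n)%N -> cofinite X' ->
  exists (psi : {linear X -> 'rV[K]_n}) (v : {linear 'rV[K]_n -> X}) (a b : R),
    [/\ range v `<=` X', 0 < a, 0 < b & a * b <= 2 * C] /\
    [/\ forall y, psi (v y) = y, forall y, l2norm y <= a * rnorm (v y),
        forall y, rnorm (v y) <= b * l2norm y & forall x, rnorm (v (psi x)) <= C * rnorm x].
Proof.
move=> C1 hP n0 cX'; have C0 : 0 < C by rewrite (lt_trans _ C1).
have [E [sE _ EX' bm [P [bP PP rP PC]]]] :=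
  hP n X' n0 (cofinite_subspace cX') (cofinite_closed cX') (cofinite_codim cX').
have : (bm_dist (@rnorm R s X) (@l2norm R s n) E setT < (2 * C)%:E)%E.
  by apply: le_lt_trans bm _; rewrite lte_fin ltr_pMl// ltr1n.
move=> /ereal_inf_lt[_ [u [v [lu lv uE vE ->]]]] uv.
have sT : subspace [set: 'rV[K]_n] by [].
have hX := @rnormZ_semb R s X.
have hl := @l2normZ n.
have X0 := @rnorm_ge0 R s X; have l0 := @l2norm_ge0 R s n.
have E0 : E 0 by case: sE.
have u0 : (0 <= opnorm (@rnorm R s X) (@l2norm R s n) E u)%E.
  by apply: opnorm_ge0 => //; exact: rnorm0.
have v0 : (0 <= opnorm (@l2norm R s n) (@rnorm R s X) setT v)%E.
  apply: opnorm_ge0 => //; have := hl 0 0; rewrite scaler0 normr0 mul0r; exact.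
pose y0 : 'rV[K]_n := const_mx 1.
have y00 : y0 != 0.
  apply/eqP => /rowP/(_ (Ordinal n0)); rewrite !mxE => /eqP.
  by rewrite oner_eq0.
have Ev y : E (v y) by case: (vE y I).
have uK y : u (v y) = y by case: (vE y I).
have [w wv] : exists w : {linear 'rV[K]_n -> X}, w =1 v.
  by apply: linearP_exists => c x y; exact: lv.
(* As 0 times +oo is 0, finiteness of the product of the two norms bounds each of them only once
   both are known to be nonzero. *)
have un0 : opnorm (@rnorm R s X) (@l2norm R s n) E u != 0.
  apply/eqP => un; have : (opnorm (@rnorm R s X) (@l2norm R s n) E u <= 0%:E)%E by rewrite un.
  move/(opnorm_leP hX hl X0 (lexx 0) sE lu) => /(_ (v y0) (Ev _)).
  rewrite uK mul0r => y0le; move/eqP: y00; apply; apply: l2norm_eq0.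
  by apply/eqP; rewrite eq_le y0le l0.
have vn0 : opnorm (@l2norm R s n) (@rnorm R s X) setT v != 0.
  apply/eqP => un; have : (opnorm (@l2norm R s n) (@rnorm R s X) setT v <= 0%:E)%E by rewrite un.
  move/(opnorm_leP hl hX l0 (lexx 0) sT lv) => /(_ y0 I).
  rewrite mul0r => y0le; have : v y0 = 0.
    by apply: rnorm0_eq0; apply/eqP; rewrite eq_le y0le X0.
  by move=> vy0; move: y00; rewrite -(uK y0) vy0 -(linear0 w) wv uK eqxx.
have [a aE] : exists a, opnorm (@rnorm R s X) (@l2norm R s n) E u = a%:E.
  move: u0 un0 uv; case: (opnorm _ _ E u) => [a|_ _|//]; first by exists a.
  by rewrite gt0_mulye ?lt0e ?vn0 ?v0.
have [b bE] : exists b, opnorm (@l2norm R s n) (@rnorm R s X) setT v = b%:E.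
  move: v0 vn0 uv; case: (opnorm _ _ setT v) => [b|_ _|//]; first by exists b.
  by rewrite gt0_muley ?lt0e ?un0 ?u0.
have a0 : 0 < a by rewrite -lte_fin -aE lt0e un0.
have b0 : 0 < b by rewrite -lte_fin -bE lt0e vn0.
have EP x : E (P x) by rewrite -rP; exists x.
have [psi psiE] : exists psi : {linear X -> 'rV[K]_n}, forall x, psi x = u (P x).
  by apply: linearP_exists => c x y; rewrite linearP lu.
have PE x : E x -> P x = x by rewrite -rP => -[z _ <-].
have vpsi x : w (psi x) = P x by rewrite wv psiE; case: (uE (P x) (EP x)).
exists psi, w, a, b; split; split=> //.
- by move=> _ [y _ <-]; rewrite wv; exact: EX'.
- by rewrite -lee_fin EFinM -aE -bE ltW.
- by move=> y; rewrite psiE wv PE.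
- move=> y; rewrite wv -{1}(uK y).
  by move: (v y) (Ev y); apply/(opnorm_leP hX hl X0 (ltW a0) sE lu); rewrite aE.
- move=> y; rewrite wv; move: y I.
  by apply/(opnorm_leP hl hX l0 (ltW b0) sT lv); rewrite bE.
- move=> x; rewrite vpsi; move: x I.
  by apply/(opnorm_leP hX hX X0 (ltW C0)) => // c x y _ _; rewrite linearP.
Qed.

End hilbertian_block.

Lemma rnorm_det_le (R : realType) (s : scalar_kind) n (M : 'M[scalar_field R s]_n) B :
  (forall i j, rnorm (M i j) <= B) -> rnorm (\det M) <= #|{perm 'I_n}|%:R * B ^+ n.
Proof.
move=> MB; rewrite /determinant (le_trans (rnorm_sum _ _ _))//.
rewrite mulr_natl -sumr_const; apply: ler_sum => /= u _.
have -> : rnorm ((-1) ^+ u * \prod_i M i (u i)) = \prod_i rnorm (M i (u i)).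
  rewrite rnormM rnormX rnormN rnorm1 expr1n mul1r.
  by elim/big_rec2 : _ => [|i x y _ <-]; rewrite ?rnorm1 ?rnormM.
have -> : B ^+ n = \prod_(i < n) B by rewrite prodr_const card_ord.
by apply: ler_prod => i _; rewrite rnorm_ge0 MB.
Qed.

(** The rank m is at least n/2, so 4^m >= 2^n and the product is at least (5/4)^n; already (5/4)^5
    exceeds 2, the factor lost by taking a near maximiser. *)
Lemma exponent_gap (R : realType) n k m : (4 < n)%N -> (k.*2 <= n)%N -> (n <= m + k)%N ->
  2 < (8 / 5)^-1 ^+ n * 4 ^+ m :> R.
Proof.
move=> n5 kn nm.
have four : 2 ^+ n <= 4 ^+ m :> R.
  have -> : 4 = 2 ^+ 2 :> R by rewrite -natrX.
  rewrite -exprM; apply: ler_weXn2l; [exact: ler1n|lia].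
apply: lt_le_trans (ler_wpM2l _ four); last by apply: exprn_ge0; rewrite invr_ge0 divr_ge0.
rewrite -exprMn (_ : (8 / 5)^-1 * 2 = 5 / 4 :> R); last by field.
apply: (@lt_le_trans _ _ ((5 / 4) ^+ 5)); first by rewrite !exprS expr0; lra.
by apply: ler_weXn2l; [lra|].
Qed.

Section block.
Variables (R : realType) (s : scalar_kind) (p r : R).
Hypotheses (r1 : 1 <= r) (rp : r <= p).
Local Notation K := (scalar_field R s).
Variables (X Y : normedModType K).
Local Notation sbound := (@summing_bound R s p r _ _).

Section near_maximal.
Variables (n : nat) (psi : {linear X -> 'rV[K]_n}) (v : {linear 'rV[K]_n -> X}) (a b : R).
Hypotheses (a0 : 0 < a) (b0 : 0 < b).
Hypothesis psiv : forall y, psi (v y) = y.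
Hypothesis va : forall y, l2norm y <= a * rnorm (v y).
Hypothesis vb : forall y, rnorm (v y) <= b * l2norm y.
Variable g : 'I_n -> {linear Y -> K^o}.
Hypothesis g1 : forall i x, rnorm (g i x : K) <= rnorm x.

Let E := range v.
(** Operators from E to Y are parametrised by the images y l of the basis vectors v (e_l); they are
    extended to X through psi. *)
Let S (y : 'I_n -> Y) (x : X) := lincomb y (psi x).
Let D (y : 'I_n -> Y) := rnorm (\det (\matrix_(l, i) (g i (y l) : K))).

Let sE : subspace E. Proof. exact: subspace_range. Qed.

Let summing_bound_exists y : exists c, sbound E (S y) c.
Proof.
have h k : exists c, sbound E (fun x => \sum_(l < n | (l < k)%N) psi x 0 l *: y l) c.
  elim: k => [|k [c hc]].
    exists 0; apply: (eq_summing_bound _ (summing_bound0 r1 rp Y sE)) => x _.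
    by rewrite big_pred0.
  have [nk|kn] := leqP n k.
    exists c; apply: (eq_summing_bound _ hc) => x _; apply: eq_bigl => l.
    by rewrite !(leq_trans (ltn_ord l))// leqW.
  pose l0 := Ordinal kn.
  have hl : sbound E (fun x => psi x 0 l0 *: y l0) (a * rnorm (y l0)).
    apply: summing_bound_rank1 => //; first by move=> d x z _ _; rewrite linearP !mxE.
    by move=> _ [z _ <-]; rewrite psiv (le_trans (rnorm_le_l2norm _ _)).
  exists (c + a * rnorm (y l0)).
  apply: (eq_summing_bound _ (summing_boundD r1 rp sE hc hl)) => x _.
  rewrite [RHS](bigD1 l0)//= addrC; congr (_ + _); apply: eq_bigl => l.
  by rewrite -val_eqE /=; lia.
have [c hc] := h n; exists c; apply: (eq_summing_bound _ hc) => x _.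
by apply: eq_bigl => l; rewrite ltn_ord.
Qed.

Let DZ c (y : 'I_n -> Y) : D (fun l => semb R s c *: y l) = `|c| ^+ n * D y.
Proof.
rewrite /D (_ : \matrix_(l, i) _ = semb R s c *: \matrix_(l, i) (g i (y l) : K)).
  by rewrite detZ rnormM rnormX rnorm_semb.
by apply/matrixP => l i; rewrite !mxE linearZ.
Qed.

Let SZ c (y : 'I_n -> Y) x : S (fun l => semb R s c *: y l) x = semb R s c *: S y x.
Proof.
rewrite /S /lincomb scaler_sumr; apply: eq_bigr => l _.
by rewrite !scalerA mulrC.
Qed.

Let normalize y c : 0 < c -> sbound E (S y) c -> sbound E (S (fun l => semb R s c^-1 *: y l)) 1.
Proof.
move=> c0 hc; have := summing_boundZ r1 rp (semb R s c^-1) sE hc.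
have -> : rnorm (semb R s c^-1) * c = 1.
  by rewrite rnorm_semb gtr0_norm ?invr_gt0// mulVf ?gt_eqF.
by apply: eq_summing_bound => x _; rewrite SZ.
Qed.

(* If the last conclusion failed, then y composed with 1 + 3 Q, rescaled by 5/8,
   would beat the supremum of D: here Q is the orthogonal projection of K^n
   onto the coordinate vectors of the elements of G `&` E, and the determinant
   of 1 + 3 Q is 4 to the rank of Q. *)
Lemma near_maximal_determinant (Y' : set Y) : subspace Y' -> (4 < n)%N ->
  (exists2 y, forall l, Y' (y l) & \det (\matrix_(l, i) (g i (y l) : K)) != 0) ->
  exists y, [/\ forall l, Y' (y l), sbound E (S y) 1,
    \det (\matrix_(l, i) (g i (y l) : K)) != 0 &
    forall G k c, subspace G -> has_codim G k -> (k.*2 <= n)%N ->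
      sbound (G `&` E) (S y) c -> 5^-1 <= c * (a * b)].
Proof.
move=> sY n5 [y0 Yy0 dy0].
pose A := [set D y | y in [set y | (forall l, Y' (y l)) /\ sbound E (S y) 1]].
have ubA : has_ubound A.
  (* The vector y l is the image of v (e_l) under an operator of norm at most 1, so the matrix
     entries are bounded independently of y. *)
  pose B0 := \sum_l rnorm (v (delta_mx 0 l)).
  exists (#|{perm 'I_n}|%:R * B0 ^+ n) => _ [y [_ hy] <-]; apply: rnorm_det_le => l i.
  rewrite mxE (le_trans (g1 _ _))//.
  have -> : y l = S y (v (delta_mx 0 l)).
    rewrite /S psiv /lincomb (bigD1 l)//= mxE !eqxx scale1r big1 ?addr0// => j jl.
    by rewrite mxE (negbTE jl) andbF scale0r.
  rewrite (le_trans (summing_bound_norm r1 rp sE hy _))//; first by exists (delta_mx 0 l).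
  by rewrite mul1r /B0 (bigD1 l)//= lerDl sumr_ge0// => j _; exact: rnorm_ge0.
have [y1 Ay1 Dy1] : exists2 y1, (forall l, Y' (y1 l)) /\ sbound E (S y1) 1 & 0 < D y1.
  have [c hc] := summing_bound_exists y0.
  have c0 : 0 <= c by case: hc.
  (* The bound c may be 0, hence the division by c + 1. *)
  have c1 : 0 < c + 1 by rewrite ltr_wpDl.
  exists (fun l => semb R s (c + 1)^-1 *: y0 l).
    split=> [l|]; first exact: subspaceZ.
    by apply: normalize => //; apply: summing_bound_le hc; rewrite lerDl.
  by rewrite DZ mulr_gt0 ?exprn_gt0 ?normr_gt0 ?invr_eq0 ?gt_eqF// rnorm_gt0.
have sup0 : 0 < sup A by apply: (lt_le_trans Dy1); apply: ub_le_sup => //; exists y1.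
have hsA : has_sup A by split=> //; exists (D y1); exists y1.
have [_ [y [Yy hy] <-] Dy] := sup_adherent (divr_gt0 sup0 (ltr0n _ 2)) hsA.
have {}Dy : sup A / 2 < D y by move: Dy; lra.
exists y; split=> //.
  by rewrite -rnorm_gt0 (lt_trans _ Dy)// divr_gt0.
move=> G k c sG Gk kn hc; rewrite leNgt; apply/negP => cab.
have [phi phiG] := has_codim_coords sG Gk.
(* In coordinates phi o v is z |-> z B, so v (z Q) lies in G for every z. *)
pose B : 'M[K]_(n, k) := \matrix_l phi (v (delta_mx 0 l)).
have phiB z : phi (v z) = z *m B.
  rewrite {1}[z]row_sum_delta !linear_sum /= mulmx_sum_row; apply: eq_bigr => l _.
  by rewrite !linearZ /= rowK.
have [Q [QQ Qa QB rQ]] := orthogonal_projection_exists B.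
(* On E this operator is S y composed with x |-> v (psi x Q), which maps E into G [&] E with norm at
   most a b. *)
have hQ : sbound E (fun x => lincomb y (psi x *m Q)) (c * (a * b)).
  have sGE : subspace (G `&` E).
    split; first by split; [case: sG|case: sE].
    by move=> d x z [Gx Ex] [Gz Ez]; split; [case: sG => _; apply|case: sE => _; apply].
  have := @summing_bound_comp R s p r r1 X Y X E (G `&` E) (fun x => v (psi x *m Q)) (S y) c (a * b).
  move=> /(_ sGE sE); rewrite /comp /S => h.
  apply: eq_summing_bound (h _ _ _ _ hc) => [x _|d x z _ _|_ [z _ <-]||_ [z _ <-]].
  - by rewrite psiv.
  - by rewrite linearP mulmxDl -scalemxAl linearP.
  - by split; [apply: phiG; rewrite phiB -mulmxA QB mulmx0|exists (psi (v z) *m Q)].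
  - by rewrite mulr_gt0.
  - rewrite psiv (le_trans (vb _))// [a * b]mulrC -mulrA ler_wpM2l ?(ltW b0)//.
    exact: le_trans (l2norm_proj _ QQ Qa) _.
pose M := 1%:M + (3 : K) *: Q.
pose y' l := lincomb y (row l M).
(* From c (a b) < 1/5 one gets 1 + 3/5 = 8/5. *)
have hy' : sbound E (S y') (8 / 5).
  have three : rnorm (3 : K) = 3 by rewrite -(rmorph_nat (semb R s)) rnorm_semb ger0_norm.
  have := summing_boundD r1 rp sE hy (summing_boundZ r1 rp 3 sE hQ).
  rewrite three => /(eq_summing_bound (S := S y')) h.
  apply: (@summing_bound_le _ _ _ _ _ _ _ _ (1 + 3 * (c * (a * b)))); first by lra.
  apply: h => x _.
  by rewrite /S /y' -lincomb_mulmx /M mulmxDr mulmx1 -scalemxAr linearD linearZ.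
have e0 : 0 < 8 / 5 :> R by lra.
have Ay2 : A (D (fun l => semb R s (8 / 5)^-1 *: y' l)).
  exists (fun l => semb R s (8 / 5)^-1 *: y' l); [split|by []].
    by move=> l; apply: (subspaceZ _ sY); apply: (subspace_lincomb _ sY).
  by apply: normalize; [exact: e0|exact: hy'].
have := ub_le_sup ubA Ay2; rewrite DZ.
have -> : D y' = 4 ^+ \rank Q * D y.
  rewrite /D (_ : \matrix_(l, i) (g i (y' l) : K) = M *m \matrix_(l, i) (g i (y l) : K)).
    rewrite det_mulmx rnormM det_idempotent//; congr (_ * _).
    rewrite rnormX -[1 + 3]/(1 + 3%:R) nat1r -(rmorph_nat (semb R s)) rnorm_semb.
    by rewrite ger0_norm.
  apply/matrixP => l i; rewrite !mxE /y' lincomb_linear /lincomb.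
  by apply: eq_bigr => j _; rewrite !mxE.
have gap := exponent_gap R n5 kn rQ.
have Dy0 : 0 < D y by rewrite (lt_trans _ Dy)// divr_gt0.
apply/negP; rewrite -ltNge mulrA gtr0_norm ?invr_gt0//.
apply: (@lt_trans _ _ (2 * D y)); first by rewrite -ltr_pdivrMl// mulrC.
by rewrite ltr_pM2r.
Qed.

End near_maximal.

(** X'' and Y'' are the constraints imposed on all later blocks: X'' adds the kernel of psi, on
    which B vanishes, and Y'' adds the subspace given by Mazur's argument for the range of B. *)
Lemma block_exists C n (X' : set X) (Y' : set Y) :
  1 < C -> property_P X C -> infinite_dim Y -> (4 < n)%N -> cofinite X' -> cofinite Y' ->
  exists (B : {linear X -> Y}) (E X'' : set X) (Y'' : set Y),
  [/\ [/\ subspace E, E `<=` X', cofinite X'', X'' `<=` X' & forall x, X'' x -> B x = 0],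
      [/\ forall x, Y' (B x), cofinite Y'', Y'' `<=` Y' &
          forall x z, Y'' z -> rnorm (B x) <= 2 * rnorm (B x + z)],
      sbound setT B C,
      (exists (psi : {linear X -> 'rV[K]_n}) (y : 'I_n -> Y), forall x, B x = lincomb y (psi x)) &
      forall G k c, subspace G -> has_codim G k -> (k.*2 <= n)%N ->
        sbound (G `&` E) B c -> (10 * C)^-1 <= c].
Proof.
move=> C1 hP hY n5 cX' cY'; have C0 : 0 < C by rewrite (lt_trans _ C1).
have [psi [v [a [b [[vX' a0 b0 ab] [psiv va vb vC]]]]]] :=
  hilbertian_block C1 hP (ltnW (ltnW (ltnW (ltnW n5)))) cX'.
have [y0 [g [Yy0 g1 dy0]]] := independent_functionals n hY cY'.
have [y [Yy hy dy key]] := near_maximal_determinant a0 b0 psiv va vb g1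
  (cofinite_subspace cY') n5 (ex_intro2 _ _ y0 Yy0 dy0).
have [A yA] := coordinates_bounded g1 dy.
have [F cF yF] := mazur_cofinite yA.
have ckpsi : cofinite [set x | psi x = 0].
  exists n, psi, (a * C); split=> // x i.
  rewrite (le_trans (rnorm_le_l2norm _ _))// (le_trans (va _))// -mulrA.
  by rewrite ler_wpM2l// ltW.
have [B BE] : exists B : {linear X -> Y}, forall x, B x = lincomb y (psi x).
  by apply: linearP_exists => c x z; rewrite !linearP.
have sEv : subspace (range v) by exact: subspace_range.
exists B, (range v), (X' `&` [set x | psi x = 0]), (Y' `&` F); split.
- split; [exact: sEv|exact: vX'|exact: cofiniteI|exact: subIsetl|].
  by move=> x [_ /= px]; rewrite BE px linear0.
- split; [|exact: cofiniteI|exact: subIsetl|by move=> x z [_ Fz]; rewrite BE; exact: yF].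
  by move=> x; rewrite BE; apply: subspace_lincomb => //; exact: cofinite_subspace.
(* B is its restriction to E, of bound 1, composed with the projection v o psi of norm at most C. *)
- have sT : subspace [set: X] by [].
  have := @summing_bound_comp R s p r r1 X Y X setT (range v) (v \o psi)
    (fun x => lincomb y (psi x)) 1 C sEv sT.
  rewrite mul1r => h; apply: eq_summing_bound (h _ _ C0 _ hy) => [x _|c x z _ _|x _|x _].
  + by rewrite /= psiv BE.
  + by rewrite /= !linearP.
  + by exists (psi x).
  + exact: vC.
- by exists psi, y.
- move=> G k c sG Gk kn hc; have c0 : 0 <= c by case: hc.
  have : sbound (G `&` range v) (fun x => lincomb y (psi x)) c.
    by apply: eq_summing_bound hc => x _; rewrite BE.
  move=> /(key G k c sG Gk kn) h.
  (* The bound 1/5 <= c (a b) and a b <= 2 C give 1 <= 10 C c. *)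
  rewrite -[_^-1]mul1r ler_pdivrMr ?mulr_gt0//.
  have := ler_wpM2l c0 ab; lra.
Qed.

End block.

(** * Assembling the blocks *)

(** a keeps its value until b has dropped to half of it or less, and then jumps down to b. For given
    i with b i > 0, j is the first jump from i on: a j is still a i >= b i, and the jump loses at
    least half of it. *)
Lemma halving_majorant (R : realType) (b : nat -> R) :
  (forall i, b i.+1 <= b i) -> (forall i, 0 <= b i) -> b k @[k --> \oo] --> 0 ->
  exists a : nat -> R, [/\ forall i, b i <= a i <= 2 * b i, forall i, a i.+1 <= a i &
    forall i, exists2 j, (i <= j)%N & b i / 2 <= a j - a j.+1].
Proof.
move=> bn b0 bl.
pose a := fix a i := if i is j.+1 then (if 2 * b i <= a j then b i else a j) else b 0%N.
have aS i : a i.+1 = if 2 * b i.+1 <= a i then b i.+1 else a i by [].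
have ab i : b i <= a i <= 2 * b i.
  elim: i => [|i /andP[IH1 IH2]]; first by rewrite /= lexx /=; have := b0 0%N; lra.
  rewrite aS; have := b0 i.+1; have := bn i; case: ifP; lra.
have an i : a i.+1 <= a i.
  by rewrite aS; have /andP[h1 h2] := ab i; have := b0 i.+1; case: ifP; lra.
exists a; split=> // i.
have [bi0|bi0] := leP (b i) 0; first by exists i => //; have := an i; lra.
have ai0 : 0 < a i by have /andP[h _] := ab i; exact: lt_le_trans h.
(* A jump must occur: otherwise a would stay at a i > 0, while a <= 2 b tends to 0. *)
have [j0 j0P] : exists j, (i <= j)%N && (a j.+1 != a j).
  apply: contrapT => nj.
  have aE k : a (i + k)%N = a i.
    elim: k => [|k IH]; first by rewrite addn0.
    rewrite addnS -IH; apply/eqP; apply: contrapT => /negP h.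
    by apply: nj; exists (i + k)%N; rewrite leq_addr.
  move/cvgrPdist_lt : bl => /(_ (a i / 2) (divr_gt0 ai0 (ltr0n _ 2)))[N _ hN].
  have := hN (i + N)%N (leq_addl _ _).
  by rewrite sub0r normrN ger0_norm//; have := ab (i + N)%N; rewrite aE; lra.
have hex : exists j, (i <= j)%N && (a j.+1 != a j) by exists j0.
case: (ex_minnP hex) => j /andP[ij aj] jmin; exists j => //.
have ajE k : (i + k <= j)%N -> a (i + k)%N = a i.
  elim: k => [|k IH] kj; first by rewrite addn0.
  have kj' : (i + k < j)%N by rewrite -addnS.
  rewrite addnS -(IH (ltnW kj')); apply/eqP; apply: contrapT => /negP h.
  by have := jmin (i + k)%N; rewrite leq_addr h => /(_ isT); rewrite leqNgt kj'.
have aji : a j = a i by have := ajE (j - i)%N; rewrite subnKC// => /(_ (leqnn _)).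
move: aj; rewrite aS; case: ifP => [h _|_ /eqP//].
have /andP[h1 h2] := ab i; lra.
Qed.

Section limits.
Variables (R : realType) (s : scalar_kind).
Local Notation K := (scalar_field R s).

Lemma complete_limit (Y : completeNormedModType K) (u : nat -> Y) (e : nat -> R) :
  (forall N M, (N <= M)%N -> rnorm (u M - u N) <= e N) ->
  (forall d, 0 < d -> exists N, forall n, (N <= n)%N -> e n <= d) ->
  exists l, forall N, rnorm (l - u N) <= e N.
Proof.
move=> ue e0.
have cu : cauchy (u @ \oo).
  apply/cauchy_ballP => d d0.
  have dE : d = semb R s (scalar_re d) by rewrite scalar_re_ge0 ?ltW.
  have d0' : 0 < scalar_re d by rewrite -(semb_lt s) -dE rmorph0.
  have [N hN] := e0 (scalar_re d / 4) (divr_gt0 d0' (ltr0n _ 4)).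
  pose A := [set u m | m in [set m | (N <= m)%N]].
  exists (A, A); first by split; exists N => // m Nm; exists m.
  move=> [_ _] [/= [m mN <-] [m' m'N <-]].
  rewrite -ball_normE /= dE normE semb_lt.
  have := rnormB (u m - u N) (u m' - u N); rewrite opprB addrA subrK.
  have := ue _ _ mN; have := ue _ _ m'N; have := hN N (leqnn N); lra.
have /cvg_ex[l ul] : cvg (u @ \oo) by exact: cauchy_cvg.
exists l => N; apply/ler_addgt0Pr => d d0.
move/cvgrPdist_le : ul => /(_ (semb R s d)).
rewrite -{1}(rmorph0 (semb R s)) semb_lt => /(_ d0)[M _ hM].
have := hM (maxn M N) (leq_maxl _ _); rewrite normE semb_le => h.
have := ue N (maxn M N) (leq_maxr _ _).
have := rnormD (l - u (maxn M N)) (u (maxn M N) - u N); rewrite addrA subrK.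
move: h; lra.
Qed.

End limits.

Section approximation_numbers.
Variables (R : realType) (s : scalar_kind) (p r : R).
Hypotheses (r1 : 1 <= r) (rp : r <= p).
Local Notation K := (scalar_field R s).
Local Notation sbound := (@summing_bound R s p r _ _).

(** On the kernel of u, whose codimension is the rank of u, T - u coincides with T. *)
Lemma gelfand_le_approx (X Y : normedModType K) (T : X -> Y) m :
  (gelfand_num p%:E r T m <= approx_num p%:E r T m)%E.
Proof.
apply: le_ereal_inf_tmp => _ [u [lu bu [k km ku]] <-].
have [w wu] := linearP_exists lu.
have {wu} uw : u = w by apply/funext => x; rewrite wu.
subst u.
apply: (@le_trans _ _ (summing_norm p%:E r [set x | w x = 0] T)).
  apply: ereal_inf_lbound; exists [set x | w x = 0] => //; split.
  - exact: subspace_ker.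
  - exact: closed_ker.
  - by exists k => //; exact: has_codim_ker.
apply: le_ereal_inf_tmp => _ [c [c0 hc] <-].
apply: (@summing_norm_le R s p r).
have sT : subspace [set: X] by [].
have hT : sbound setT (T \- w) c by split; [exact: ltW|exact: hc].
have sk := subspace_ker w.
have := summing_bound_restrict r1 sT sk (subsetT _) hT.
by apply: eq_summing_bound => x /= wx; rewrite wx subr0.
Qed.

Lemma lincomb_row_mx (V : lmodType K) m n (y : 'I_m -> V) (z : 'I_n -> V) a b :
  lincomb y a + lincomb z b =
  lincomb (fun i => match fintype.split i with inl j => y j | inr j => z j end) (row_mx a b).
Proof.
rewrite /lincomb big_split_ord /=; congr (_ + _); apply: eq_bigr => i _.
  by rewrite row_mxEl (unsplitK (inl _ i)).
by rewrite row_mxEr (unsplitK (inr _ i)).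
Qed.

Section construction.
Variables (X Y : normedModType K) (C : R).
Hypotheses (C1 : 1 < C) (hP : property_P X C) (hY : infinite_dim Y).

Lemma blocks_exist : exists (B : nat -> {linear X -> Y}) (E : nat -> set X),
  [/\ forall i, subspace (E i), forall i j x, (i < j)%N -> E j x -> B i x = 0,
      forall i x, exists F : set Y, [/\ subspace F, forall j x, (i < j)%N -> F (B j x) &
        forall z, F z -> rnorm (B i x) <= 2 * rnorm (B i x + z)] &
      forall i, [/\ sbound setT (B i) C,
        exists (psi : X -> 'rV[K]_(5 ^ i.+1)) y, forall x, B i x = lincomb y (psi x) &
        forall G k c, subspace G -> has_codim G k -> (k.*2 <= 5 ^ i.+1)%N ->
          sbound (G `&` E i) (B i) c -> (10 * C)^-1 <= c]].
Proof.
pose W := ({linear X -> Y} * set X * (set X * set Y))%type.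
pose P n (q : set X * set Y) (w : W) := 
  [/\ [/\ subspace w.1.2, w.1.2 `<=` q.1, cofinite w.2.1, w.2.1 `<=` q.1 & forall x, w.2.1 x -> w.1.1 x = 0],
      [/\ forall x, q.2 (w.1.1 x), cofinite w.2.2, w.2.2 `<=` q.2 &
          forall x z, w.2.2 z -> rnorm (w.1.1 x) <= 2 * rnorm (w.1.1 x + z)],
      sbound setT (w.1.1) C,
      (exists (psi : {linear X -> 'rV[K]_n}) (y : 'I_n -> Y), forall x, w.1.1 x = lincomb y (psi x)) &
      forall G k c, subspace G -> has_codim G k -> (k.*2 <= n)%N ->
        sbound (G `&` w.1.2) w.1.1 c -> (10 * C)^-1 <= c].
(* The cofiniteness conditions are put inside the chosen property so that f is total: the recursion
   [st] can then be defined before its members are known to be cofinite. [st i] holds the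
   constraints on the i-th block. *)
have /choice[f fP] : forall iq : nat * (set X * set Y), exists w,
    cofinite iq.2.1 -> cofinite iq.2.2 -> P (5 ^ iq.1.+1)%N iq.2 w.
  move=> [i q] /=; have [[c1 c2]|nc] := pselect (cofinite q.1 /\ cofinite q.2); last first.
    by exists (\0 : {linear X -> Y}, set0, q) => c1 c2; case: nc.
  have n5 : (4 < 5 ^ i.+1)%N by rewrite expnS (leq_trans (_ : 5 <= 5 * 1)%N)// leq_mul// expn_gt0.
  have [B [E [X'' [Y'' h]]]] := block_exists r1 rp C1 hP hY n5 c1 c2.
  by exists (B, E, (X'', Y'')) => _ _; exact: h.
pose st := fix st i := if i is j.+1 then (f (j, st j)).2 else (setT, setT).
have stc i : cofinite (st i).1 /\ cofinite (st i).2.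
  elim: i => [|i [IH1 IH2]]; first by split; exact: cofiniteT.
  by have [[_ _ ? _ _] [_ ? _ _] _ _ _] := fP (i, st i) IH1 IH2.
have {}fP i : P (5 ^ i.+1)%N (st i) (f (i, st i)) by apply: fP; case: (stc i).
have stn i j : (i <= j)%N -> (st j).1 `<=` (st i).1 /\ (st j).2 `<=` (st i).2.
  move=> ij; rewrite -(subnKC ij); elim: (j - i)%N => [|k [IH1 IH2]]; first by rewrite addn0; split=> x.
  rewrite addnS; have [[_ _ _ h1 _] [_ _ h2 _] _ _ _] := fP (i + k)%N.
  by split=> x ?; [apply: IH1; exact: h1|apply: IH2; exact: h2].
exists (fun i => (f (i, st i)).1.1), (fun i => (f (i, st i)).1.2); split.
- by move=> i; have [[]] := fP i.
- move=> i j x ij Ex; have [[_ _ _ _ h] _ _ _ _] := fP i.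
  have [[_ hj _ _ _] _ _ _ _] := fP j.
  by apply: h; apply: (stn i.+1 j ij).1; exact: hj.
- move=> i x; exists (st i.+1).2; split.
  + by apply: cofinite_subspace; case: (stc i.+1).
  + move=> j z ij; have [_ [h _ _ _] _ _ _] := fP j.
    by apply: (stn i.+1 j ij).2; exact: h.
  + by move=> z Fz; have [_ [_ _ _ h] _ _ _] := fP i; exact: h.
- move=> i; have [_ _ h1 [psi [y h2]] h3] := fP i; split=> //.
  by exists psi, y.
Qed.

End construction.
End approximation_numbers.

(** * The weighted sum of the blocks *)

Section operator.
Variables (R : realType) (s : scalar_kind) (p r : R).
Hypotheses (r1 : 1 <= r) (rp : r <= p).
Local Notation K := (scalar_field R s).
Local Notation sbound := (@summing_bound R s p r _ _).
Variables (X : normedModType K) (Y : completeNormedModType K) (C : R).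
Variables (B : nat -> {linear X -> Y}) (E : nat -> set X) (a : nat -> R).
Hypotheses (C1 : 1 < C) (a0 : forall i, 0 <= a i) (an : forall i, a i.+1 <= a i).
Hypothesis al : forall d, 0 < d -> exists N, forall n, (N <= n)%N -> a n <= d.
Hypothesis sE : forall i, subspace (E i).
Hypothesis BE : forall i j x, (i < j)%N -> E j x -> B i x = 0.
Hypothesis BF : forall i x, exists F : set Y, [/\ subspace F,
  forall j x, (i < j)%N -> F (B j x) &
  forall z, F z -> rnorm (B i x) <= 2 * rnorm (B i x + z)].
Hypothesis Bb : forall i, sbound setT (B i) C.

Definition block_weight i := 2 * (a i - a i.+1) / C.
Definition partial_sum N x := \sum_(i < N) semb R s (block_weight i) *: B i x.

Let C0 : 0 < C. Proof. by rewrite (lt_trans _ C1). Qed.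

Let block_weight_ge0 i : 0 <= block_weight i.
Proof. by rewrite /block_weight divr_ge0 ?(ltW C0)// mulr_ge0// subr_ge0. Qed.

Let sT : subspace [set: X]. Proof. by []. Qed.

Let partial_sum_diff_bound N k : 
  sbound setT (fun x => partial_sum (N + k) x - partial_sum N x) (2 * (a N - a (N + k)%N)).
Proof.
elim: k => [|k IH].
  rewrite addn0 subrr mulr0.
  by apply: (eq_summing_bound _ (summing_bound0 r1 rp Y sT)) => x _; rewrite subrr.
have h := summing_boundZ r1 rp (semb R s (block_weight (N + k)%N)) sT (Bb (N + k)%N).
have := summing_boundD r1 rp sT IH h.
have -> : 2 * (a N - a (N + k)%N) + rnorm (semb R s (block_weight (N + k)%N)) * C =
    2 * (a N - a (N + k.+1)%N).
  by rewrite rnorm_semb ger0_norm// addnS /block_weight; field; rewrite gt_eqF.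
apply: eq_summing_bound => x _.
by rewrite addnS /partial_sum big_ord_recr /= addrAC.
Qed.

Let partial_sum_diff_le N M x : (N <= M)%N -> rnorm (partial_sum M x - partial_sum N x) <= 2 * a N * rnorm x.
Proof.
move=> NM; rewrite -(subnKC NM).
apply: le_trans (summing_bound_norm r1 rp sT (partial_sum_diff_bound N (M - N)) I) _.
by rewrite ler_wpM2r ?rnorm_ge0// ler_wpM2l// gerBl.
Qed.

Let small c d : 0 <= c -> 0 < d -> exists N, forall n, (N <= n)%N -> 2 * a n * c <= d.
Proof.
move=> c0 d0; have e0 : 0 < d / (2 * (c + 1)) by rewrite divr_gt0// mulr_gt0// ltr_wpDl.
have [N hN] := al e0; exists N => n /hN h.
apply: (@le_trans _ _ (2 * a n * (c + 1))); first by rewrite ler_wpM2l ?mulr_ge0// lerDl.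
by move: h; rewrite ler_pdivlMr ?mulr_gt0 ?ltr_wpDl// mulrA [a n * 2]mulrC.
Qed.

Lemma partial_sum_linear N : linear (partial_sum N).
Proof.
move=> c x y; rewrite /partial_sum scaler_sumr -big_split /=; apply: eq_bigr => i _.
by rewrite linearP scalerDr !scalerA mulrC.
Qed.

Lemma partial_sum_bounded N x : rnorm (partial_sum N x) <= 2 * a 0 * rnorm x.
Proof.
by have := partial_sum_diff_le x (leq0n N); rewrite {2}/partial_sum big_ord0 subr0.
Qed.

(** T is the pointwise limit of the partial sums. The third property isolates a single block on
    [E j]: the earlier ones vanish there, and the later ones have values in F, where they cancel at
    most half of the norm of the j-th term. *)
Lemma block_sum_exists : exists T : {linear X -> Y}, [/\ bounded_op T,
  forall N, sbound setT (fun x => T x - partial_sum N x) (2 * a N) &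
  forall G j c, subspace G -> 0 < block_weight j -> sbound (G `&` E j) T c ->
    sbound (G `&` E j) (B j) (2 / block_weight j * c)].
Proof.
have /choice[T0 hT0] : forall x, exists l, forall N, rnorm (l - partial_sum N x) <= 2 * a N * rnorm x.
  move=> x; apply: complete_limit; first by move=> N M; exact: partial_sum_diff_le.
  by move=> d d0; apply: small; rewrite ?rnorm_ge0.
have [|T TE] := @linearP_exists K X Y T0.
  (* The partial sums are linear, so the defect of linearity of the limit is at most 2 a_N w for
     every N. *)
  move=> c x y; apply/eqP; rewrite -subr_eq0; apply/eqP/rnorm0_eq0.
  apply/eqP; rewrite eq_le rnorm_ge0 andbT; apply/ler_addgt0Pr => d d0; rewrite add0r.
  pose w := rnorm (c *: x + y) + (rnorm c * rnorm x + rnorm y).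
  have w0 : 0 <= w by rewrite !addr_ge0 ?mulr_ge0 ?rnorm_ge0.
  have [N /(_ N (leqnn _)) hN] := small w0 d0; apply: le_trans hN.
  have -> : T0 (c *: x + y) - (c *: T0 x + T0 y) =
    (T0 (c *: x + y) - partial_sum N (c *: x + y)) -
    (c *: (T0 x - partial_sum N x) + (T0 y - partial_sum N y)).
    by rewrite partial_sum_linear scalerBr addrACA -opprD opprB addrA subrK.
  rewrite (le_trans (rnormB _ _))// /w mulrDr lerD// (le_trans (rnormD _ _))// mulrDr lerD//.
  by rewrite rnormZ mulrCA ler_wpM2l ?rnorm_ge0.
have hT N x : rnorm (T x - partial_sum N x) <= 2 * a N * rnorm x by rewrite TE.
exists T; split.
- apply/bounded_opP; exists (2 * a 0%N) => x; have := hT 0%N x.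
  by rewrite /partial_sum big_ord0 subr0.
- move=> N; have := @summing_bound_lim R s p r r1 rp X Y setT
    (fun k x => partial_sum (N + k) x - partial_sum N x)
    (fun x => T x - partial_sum N x) (2 * a N) sT.
  apply; first by rewrite mulr_ge0.
    move=> k; apply: summing_bound_le (partial_sum_diff_bound N k).
    by rewrite ler_wpM2l// gerBl.
  move=> x _ d d0; have [M hM] := small (rnorm_ge0 x) d0; exists M => k Mk.
  by rewrite opprB addrA subrK (le_trans (hT _ _))// hM// (leq_trans Mk)// leq_addl.
- move=> G j c sG bj; have sGE : subspace (G `&` E j).
    split; first by split; [case: sG|case: (sE j)].
    by move=> d x z [Gx Ex] [Gz Ez]; split; [case: sG => _; apply|case: (sE j) => _; apply].
  apply: summing_bound_domination => //; first by rewrite divr_ge0 ?(ltW bj).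
  move=> x [_ Ex]; have [F [sF FB Fz]] := BF j x.
  have h N : rnorm (semb R s (block_weight j) *: B j x) <=
      2 * (rnorm (T x) + rnorm (T x - partial_sum (j.+1 + N) x)).
    pose z := \sum_(i < N) semb R s (block_weight (j.+1 + i)%N) *: B (j.+1 + i)%N x.
    have Fzz : F ((semb R s (block_weight j))^-1 *: z).
      apply: subspaceZ => //; apply: subspace_sum => // i _; apply: subspaceZ => //.
      by apply: FB; rewrite ltnS leq_addr.
    (* Here z collects the blocks after j. *)
    have pz : partial_sum (j.+1 + N) x = semb R s (block_weight j) *: B j x + z.
      rewrite /partial_sum big_split_ord /= big_ord_recr /= big1 ?add0r// => i _.
      by rewrite (BE (ltn_ord i) Ex) scaler0.
    have bjK : semb R s (block_weight j) != 0.
      by rewrite -(rmorph0 (semb R s)) (inj_eq (can_inj (@sembK R s))) gt_eqF.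
    have := ler_wpM2l (ltW bj) (Fz _ Fzz); rewrite mulrCA.
    rewrite -{1}(gtr0_norm bj) -{2}(gtr0_norm bj) -!rnormZ_semb scalerDr scalerA mulfV// scale1r -pz.
    move=> /le_trans; apply; rewrite ler_wpM2l//.
    by have := rnormB (T x) (T x - partial_sum (j.+1 + N) x); rewrite opprB addrC subrK.
  have : rnorm (semb R s (block_weight j) *: B j x) <= 2 * rnorm (T x).
    apply/ler_addgt0Pr => d d0; have [M hM] := small (rnorm_ge0 x) (divr_gt0 d0 (ltr0n _ 2)).
    apply: (le_trans (h M)); rewrite mulrDr lerD2l.
    have := hM (j.+1 + M)%N (leq_addl _ _); have := hT (j.+1 + M)%N x; lra.
  by rewrite rnormZ_semb gtr0_norm// -ler_pdivlMl// mulrA [_^-1 * 2]mulrC.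
Qed.

Lemma partial_sum_rank (d : nat -> nat) N :
  (forall i, exists (psi : X -> 'rV[K]_(d i)) y, forall x, B i x = lincomb y (psi x)) ->
  exists (psi : X -> 'rV[K]_(\sum_(i < N) d i)) y, forall x, partial_sum N x = lincomb y (psi x).
Proof.
move=> hB; elim: N => [|N [psi [y hy]]].
  rewrite big_ord0; exists (fun=> 0), (fun=> 0) => x.
  by rewrite /partial_sum big_ord0 linear0.
rewrite big_ord_recr /=; have [psi' [y' hy']] := hB N.
exists (fun x => row_mx (psi x) (semb R s (block_weight N) *: psi' x)).
exists (fun i => match fintype.split i with inl j => y j | inr j => y' j end) => x.
by rewrite -lincomb_row_mx linearZ /= -hy' -hy /partial_sum big_ord_recr.
Qed.

End operator.

(** A geometric sum, which counts the total rank of the first i blocks. *)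
Lemma sum_pow5 i : (4 * \sum_(l < i) 5 ^ l.+1 + 5 = 5 * 5 ^ i)%N.
Proof.
elim: i => [|i IH]; first by rewrite big_ord0.
by rewrite big_ord_recr mulnDr addnAC IH -expnS -mulSn.
Qed.

Unset Implicit Arguments.

Theorem theorem1p7 (R : realType) (s : scalar_kind)
    (X : completeNormedModType (scalar_field R s)) (C : R)
    (hX : infinite_dim X) (hC : 1 < C) (hP : property_P X C)
    (Y : completeNormedModType (scalar_field R s)) (hY : infinite_dim Y)
    (alpha : nat -> R)
    (alpha_noninc : forall k, (1 <= k)%N -> alpha k.+1 <= alpha k)
    (alpha_ge0 : forall k, (1 <= k)%N -> 0 <= alpha k)
    (alpha_lim : alpha k @[k --> \oo] --> 0)
    (t : \bar R) (r : R)
    (hr : 1 <= r) (hrt : (r%:E <= Order.min 2%:E t)%E)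
    (hrt2 : ((r^-1)%:E - t^-1 < (2^-1)%:E)%E) :
  exists T : {linear X -> Y}, bounded_op T /\
    forall m : nat, (1 <= m)%N ->
      [/\ (((20 * C ^+ 2)^-1 * alpha (18 * m)%N)%:E <= gelfand_num t r T m)%E,
          (gelfand_num t r T m <= approx_num t r T m)%E &
          (approx_num t r T m
             <= (4 * alpha `|Num.ceil ((4 * m)%:R / 5 : R)|%N)%:E)%E].
Proof.
(* For t = +oo the last hypothesis reads 1/r < 1/2, against r <= 2; so t is finite. *)
have [p rp tp] : exists2 p, r <= p & t = p%:E.
  move: (hrt); rewrite le_min lee_fin => /andP[r2 rt].
  case: t rt hrt hrt2 => [p|_ _|//]; first by rewrite lee_fin => rp _ _; exists p.
  rewrite invey sube0 lte_fin ltf_pV2 ?posrE ?ltr0n ?(lt_le_trans ltr01 hr)//.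
  by rewrite ltNge r2.
subst t; move=> {hrt hrt2 hX}.
have C0 : 0 < C by rewrite (lt_trans _ hC).
have amono i j : (1 <= i)%N -> (i <= j)%N -> alpha j <= alpha i.
  move=> i1 ij; rewrite -(subnKC ij); elim: (j - i)%N => [|k IH]; first by rewrite addn0.
  by rewrite addnS (le_trans _ IH)// alpha_noninc// ltn_addr.
pose b i := alpha (5 ^ i.+1)%N.
have pos5 i : (0 < 5 ^ i)%N by rewrite expn_gt0.
have id5 i : (i <= 5 ^ i.+1)%N by rewrite ltnW// (leq_trans (ltn_expl i (_ : 1 < 5)%N))// leq_exp2l.
have bl : b k @[k --> \oo] --> 0.
  apply/cvgrPdist_le => e e0; move/cvgrPdist_le : alpha_lim => /(_ e e0)[N _ hN].
  by exists N => // k /= Nk; apply: hN => /=; exact: leq_trans (id5 k).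
have [a [ab an ad]] := halving_majorant
  (fun i => amono _ _ (pos5 i.+1) (leq_pexp2l (isT : 0 < 5)%N (leqnSn i.+1)))
  (fun i => alpha_ge0 _ (pos5 i.+1)) bl.
have a0 i : 0 <= a i.
  by have /andP[h _] := ab i; exact: le_trans (alpha_ge0 _ (pos5 i.+1)) h.
have al d : 0 < d -> exists N, forall n, (N <= n)%N -> a n <= d.
  move=> d0; move/cvgrPdist_le : bl => /(_ (d / 2) (divr_gt0 d0 (ltr0n _ 2)))[N _ hN].
  exists N => n /hN; rewrite sub0r normrN => /(le_trans (ler_norm _)).
  by have /andP[_] := ab n; rewrite /b /=; lra.
have [B [E [sE BE BF Bi]]] := blocks_exist hr rp hC hP hY.
have Bb i : summing_bound p r setT (B i) C by case: (Bi i).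
have [T [bT TU TL]] := block_sum_exists hr rp hC a0 an al sE BE BF Bb.
have sT : subspace [set: X] by [].
exists T; split=> // m m1; split; last 1 first.
- pose N i := (\sum_(l < i) 5 ^ l.+1)%N.
  (* The first i blocks have total rank at most N i < m, so their sum is admissible in the
     approximation number; the remainder is bounded by 2 a_i. *)
  have [i iN] : exists i, (N i < m <= N i.+1)%N.
    have hex : exists i, (m <= N i.+1)%N.
      exists m; rewrite /N big_ord_recr /=; apply: leq_trans (leq_addl _ _).
      exact: id5.
    case: (ex_minnP hex) => i mi imin; exists i; rewrite mi andbT.
    case: i imin {mi} => [|i] imin; first by rewrite /N big_ord0.
    by rewrite ltnNge; apply/negP => /imin; rewrite ltnn.
  have /andP[Nm mN] := iN.
  have [S SE] := linearP_exists (partial_sum_linear C B a i).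
  apply: (@le_trans _ _ (2 * a i)%:E).
    apply: (@le_trans _ _ (summing_norm p%:E r setT (T \- S))).
      apply: ereal_inf_lbound; exists S => //; split.
      - exact: linearP.
      - apply/bounded_opP; exists (2 * a 0%N) => x; rewrite SE.
        exact: (partial_sum_bounded hr rp hC a0 an Bb).
      - have [psi [y hy]] := partial_sum_rank C a i (fun i => let: And3 _ h _ := Bi i in h).
        have [|k kn hk] := @finite_rank_has_dim _ _ _ S _ y.
          by move=> x; exists (psi x); rewrite SE.
        by exists k => //; exact: leq_ltn_trans Nm.
    apply: (@summing_norm_le R s p r).
    by apply: (eq_summing_bound _ (TU i)) => x _; rewrite /= SE.
  rewrite lee_fin; have /andP[_ /(ler_wpM2l (ler0n R 2))] := ab i; move/le_trans; apply.
  rewrite mulrA -natrM ler_wpM2l//.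
  have c0 : 0 < (4 * m)%:R / 5 :> R by rewrite divr_gt0// ltr0n muln_gt0.
  have := Num.Theory.ceil_gt0 ((4 * m)%:R / 5 : R); rewrite c0 => cp.
  apply: amono; first by rewrite absz_gt0 gt_eqF.
  (* From m <= N (i+1) and [sum_pow5], 4 m <= 5 * 5^(i+1) - 5, so the ceiling of 4m/5 is at most
     5^(i+1). *)
  rewrite -lez_nat gtz0_abs// Num.Theory.ceil_le_int ler_pdivrMr// -pmulrn -natrM ler_nat.
  by have := sum_pow5 i.+1; rewrite -/(N i.+1); move: mN; rewrite -[(5 * 5 ^ _)%N]mulnC; lia.
- apply: le_ereal_inf_tmp => _ [G [sG _ [k km hk]] <-].
  apply: (@summing_norm_ge R s p r) => c hc.
  (* Dimension at least 2m makes the codimension k < m of G at most half of it; minimality of i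
     keeps 5^(i+1) below 10m unless i = 0. *)
  have hex : exists i, (m.*2 <= 5 ^ i.+1)%N by exists m.*2; exact: id5.
  case: (ex_minnP hex) => i mi imin.
  have i18 : (5 ^ i.+1 <= 18 * m)%N.
    case: i imin {mi} => [|i] imin; first by rewrite expn1; lia.
    have : (5 ^ i.+1 < m.*2)%N by rewrite ltnNge; apply/negP => /imin; rewrite ltnn.
    by rewrite (expnS 5 i.+1); lia.
  have bi : alpha (18 * m)%N <= b i by exact: amono.
  apply: (@le_trans _ _ ((20 * C ^+ 2)^-1 * b i)).
    by rewrite ler_wpM2l// invr_ge0 mulr_ge0// sqr_ge0.
  have c0 : 0 <= c by case: hc.
  have [bi0|bi0] := leP (b i) 0.
    by apply: le_trans c0; rewrite mulr_ge0_le0// invr_ge0 mulr_ge0// sqr_ge0.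
  (* Block j has a weight of at least b i / C; as j >= i, its dimension is still at least 2k. *)
  have [j ij] := ad i; rewrite -[alpha _]/(b i) => bj.
  have wj : b i / C <= block_weight C a j.
    by rewrite /block_weight ler_pM2r ?invr_gt0//; lra.
  have wj0 : 0 < block_weight C a j by apply: lt_le_trans wj; rewrite divr_gt0.
  have [_ _ key] := Bi j.
  have sGE : subspace (G `&` E j).
    split; first by split; [case: sG|case: (sE j)].
    by move=> d x z [Gx Ex] [Gz Ez]; split; [case: sG => _; apply|case: (sE j) => _; apply].
  have hcE : summing_bound p r (G `&` E j) T c.
    by apply: (summing_bound_restrict hr sG sGE _ hc); exact: subIsetl.
  have kj : (k.*2 <= 5 ^ j.+1)%N.
    apply: leq_trans (leq_trans mi _); first by rewrite leq_double ltnW.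
    by rewrite leq_exp2l.
  have := key G k _ sG hk kj (TL G j c sG wj0 hcE).
  rewrite mulrAC ler_pdivlMr// => h.
  have h2 := le_trans (ler_wpM2l _ wj) h.
  have : (10 * C)^-1 * (b i / C) <= 2 * c by apply: h2; rewrite invr_ge0 mulr_ge0// ltW.
  have -> : (10 * C)^-1 * (b i / C) = 2 * ((20 * C ^+ 2)^-1 * b i) by field; rewrite gt_eqF.
  by rewrite ler_pM2l.
- exact: gelfand_le_approx.
Qed.
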